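(* Let $\lambda>0$ and $c>0$, and let $(X(t),Y(t))_{t\ge 0}$ be the planar random flight with speed $c$ and Poisson rate $\lambda$ started at $(0,0)$. For each $n\ge1$ suppose it is observed at the times $t_i=i\Delta_n$, $i=0,1,\dots,n$. Put $(X_i,Y_i)=(X(t_i),Y(t_i))$, $\eta_i=\sqrt{(X_i-X_{i-1})^2+(Y_i-Y_{i-1})^2}$ for $i=1,\dots,n$, $$G_n=\frac{1}{n\Delta_n}\sum_{i=1}^n\mathbf 1_{\{\eta_i<c\Delta_n\}},\qquad \dot\lambda_n=-\frac{1}{\Delta_n}\log\left(1-\Delta_nG_n\right).$$ If $n\Delta_n=T\to\infty$ and $\Delta_n\to0$ as $n\to\infty$, then $\dot\lambda_n$ is a consistent, asymptotically normal and asymptotically efficient estimator of $\lambda$: $\dot\lambda_n\to\lambda$ in probability and $$\sqrt{n\Delta_n}\,(\dot\lambda_n-\lambda)\overset{d}{\longrightarrow}N(0,\lambda).$$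
   Context: Planar random flight: let $N$ be a homogeneous Poisson process of rate $\lambda>0$ with event times $s_1<s_2<\cdots$, and let $\theta_1,\theta_2,\dots$ be i.i.d. uniform on $(0,2\pi]$, independent of $N$. With $s_0=0$ and, for given $t$, $s_{N(t)+1}$ replaced by $t$, the flight with speed $c>0$ started at $(x_0,y_0)$ is $X(t)=x_0+c\sum_{j=1}^{N(t)+1}(s_j-s_{j-1})\cos\theta_j$, $Y(t)=y_0+c\sum_{j=1}^{N(t)+1}(s_j-s_{j-1})\sin\theta_j$. The speed $c$ is known and $\lambda$ is the unknown parameter. On the event $\Delta_nG_n=1$ (all intervals contain a change of direction) the estimator is given the value $+\infty$. Asymptotic efficiency means that the limiting variance $\lambda$ equals that of $\sqrt{T}(N(T)/T-\lambda)$, where $N(T)/T$ is the optimal estimator when the flight is observed continuously on $[0,T]$. *)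

(* Defs.v *)
From HB Require Import structures.
From mathcomp Require Import all_boot all_order all_algebra.
From mathcomp Require Import all_classical all_reals all_analysis.

Set Implicit Arguments.
Unset Strict Implicit.
Unset Printing Implicit Defensive.
Import Order.TTheory GRing.Theory Num.Theory.
Import numFieldNormedType.Exports.
Local Open Scope classical_set_scope.
Local Open Scope ring_scope.

Section independence.
Context (d : measure_display) (T : measurableType d) (R : realType).
Context (P : probability T R).
Local Open Scope ereal_scope.

Definition mutually_independent (I : eqType) (F : I -> set_system T) : Prop :=
  forall (J : seq I) (A : I -> set T), uniq J ->
    (forall i, i \in J -> F i (A i)) ->
    P (\big[setI/setT]_(i <- J) A i) = \big[*%E/1]_(i <- J) P (A i).

Definition independent2 (F G : set_system T) : Prop :=
  forall A B, F A -> G B -> P (A `&` B) = P A * P B.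

End independence.

Section sigma_fields.
Context (d d' : measure_display) (T : measurableType d) (T' : measurableType d').

Definition sigma_of (X : T -> T') : set_system T :=
  preimage_set_system setT X measurable.

Definition sigma_of_family (I : Type) (D : set I) (X : I -> T -> T') :
    set_system T :=
  <<s \bigcup_(i in D) sigma_of (X i) >>.

End sigma_fields.

Section random_flight.
Context (d : measure_display) (T : measurableType d) (R : realType).
Context (P : probability T R).

(* The difference of naturals is truncated; the paths are nondecreasing by
   [event_times] below, so that it is the true increment. *)
Definition increment (N : R -> {RV P >-> nat}) (a b : R) (w : T) : nat :=
  (N b w - N a w)%N.

(* Only the times t >= 0 of the family N are meaningful.
   [poisson_prob]'s third argument is a dummy; for rate 0 it is the Dirac mass
   at 0. *)
Definition poisson_process (lambda : R) (N : R -> {RV P >-> nat}) : Prop :=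
  [/\ forall w, N 0 w = 0%N,
      forall t : nat -> R, 0 <= t 0%N -> (forall i, t i <= t i.+1) ->
        mutually_independent P
          (fun i : nat => sigma_of (increment N (t i) (t i.+1)))
    & forall a b : R, 0 <= a -> a <= b -> forall A : set nat,
        P (increment N a b @^-1` A) = poisson_prob (lambda * (b - a)) 0%N A].

(* N counts the points s 1 < s 2 < ...; s 0 = 0 is the convention s_0 = 0. *)
Definition event_times (N : R -> {RV P >-> nat}) (s : nat -> T -> R) : Prop :=
  forall w, [/\ s 0%N w = 0, forall k, s k w < s k.+1 w
    & forall (t : R) (k : nat), 0 <= t -> (s k w <= t) = (k <= N t w)%N].

Lemma pi2_gt0 : 0 < 2 * pi :> R.
Proof. by rewrite mulr_gt0 ?pi_gt0. Qed.

(* theta j is the (j+1)-st direction.  The law is that of the uniform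
   distribution on (0, 2 pi], the endpoints having mass 0. *)
Definition iid_uniform_directions (theta : nat -> {RV P >-> R}) : Prop :=
  mutually_independent P (fun j : nat => sigma_of (theta j)) /\
  forall (j : nat) (A : set R), measurable A ->
    P (theta j @^-1` A) = uniform_prob pi2_gt0 A.

Definition independent_directions (N : R -> {RV P >-> nat})
    (theta : nat -> {RV P >-> R}) : Prop :=
  independent2 P (sigma_of_family [set t : R | 0 <= t] (fun t => N t : T -> nat))
                 (sigma_of_family [set: nat] (fun j => theta j : T -> R)).

Section motion.
Context (c : R) (N : R -> {RV P >-> nat}) (s : nat -> T -> R).
Context (theta : nat -> {RV P >-> R}).

(* duration of the (j+1)-st leg, j <= N t: the last one is cut at time t *)
Definition leg (t : R) (j : nat) (w : T) : R :=
  (if j == N t w then t else s j.+1 w) - s j w.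

Definition flight_x (x0 t : R) (w : T) : R :=
  x0 + c * \sum_(0 <= j < (N t w).+1) leg t j w * cos (theta j w).

Definition flight_y (y0 t : R) (w : T) : R :=
  y0 + c * \sum_(0 <= j < (N t w).+1) leg t j w * sin (theta j w).

End motion.

Section estimator.
Context (c : R) (X Y : R -> T -> R) (Delta : nat -> R).

(* eta n i is used for 1 <= i <= n *)
Definition eta (n i : nat) (w : T) : R :=
  Num.sqrt ((X (i%:R * Delta n) w - X (i.-1%:R * Delta n) w) ^+ 2
          + (Y (i%:R * Delta n) w - Y (i.-1%:R * Delta n) w) ^+ 2).

Definition G_stat (n : nat) (w : T) : R :=
  (n%:R * Delta n)^-1
  * \sum_(1 <= i < n.+1) (if eta n i w < c * Delta n then 1 else 0).

Definition lambda_dot (n : nat) (w : T) : \bar R :=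
  if Delta n * G_stat n w == 1 then +oo%E
  else (- (Delta n)^-1 * ln (1 - Delta n * G_stat n w))%:E.

End estimator.

End random_flight.

Section asymptotics.
Context (d : measure_display) (T : measurableType d) (R : realType).
Context (P : probability T R).
Local Open Scope ereal_scope.

Definition cvg_in_probability (Z : nat -> T -> \bar R) (l : R) : Prop :=
  forall e : R, (0 < e)%R ->
    P [set w | e%:E <= `|Z n w - l%:E| ] @[n --> \oo] --> 0.

(* Convergence of the distribution functions at the continuity points of the
   limit.  The Z i may take infinite values, the limit law lives on R. *)
Definition cvg_in_distribution (I : Type) (F : set_system I)
    (Z : I -> T -> \bar R) (mu : set R -> \bar R) : Prop :=
  forall x : R, {for x, continuous (fun y : R => mu `]-oo, y]%classic)} ->
    P [set w | Z i w <= x%:E] @[i --> F] --> mu `]-oo, x]%classic.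

(* rate * (est - lambda) converges in law to N(0, v); [normal_prob] takes the
   standard deviation. *)
Definition asymptotically_normal (I : Type) (F : set_system I) (rate : I -> R)
    (est : I -> T -> \bar R) (lambda v : R) : Prop :=
  cvg_in_distribution F
    (fun i w => (rate i)%:E * (est i w - lambda%:E))
    (normal_prob 0 (Num.sqrt v)).

(* The limiting variance of est is that of N(t)/t, the optimal estimator under
   continuous observation of the flight on [0, t]. *)
Definition asymptotically_efficient (N : R -> {RV P >-> nat}) (lambda : R)
    (rate : nat -> R) (est : nat -> T -> \bar R) : Prop :=
  exists v : R, [/\ (0 < v)%R,
    asymptotically_normal \oo rate est lambda v
  & asymptotically_normal (+oo%R : set_system R) Num.sqrt
      (fun t w => ((N t w)%:R / t)%:E) lambda v].

End asymptotics.

(* Main.v *)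
Require Import Defs.
From HB Require Import structures.
From mathcomp Require Import all_boot all_order all_algebra.
From mathcomp Require Import all_classical all_reals all_analysis.
From mathcomp Require Import measurable_realfun.
From mathcomp Require Import ring lra.

Set Implicit Arguments.
Unset Strict Implicit.
Unset Printing Implicit Defensive.
Import Order.TTheory GRing.Theory Num.Theory.
Import numFieldNormedType.Exports.
Local Open Scope classical_set_scope.
Local Open Scope ring_scope.

(** A flight that keeps its direction during a cell of length Delta covers the
    full distance c Delta. Almost surely a change of direction in a cell makes the
    displacement strictly shorter, because consecutive directions differ and no
    change falls on the end of a cell ([displacement_lt]). Hence n Delta G_n has the
    law of the number K of cells that contain an event of the Poisson process
    ([slow_count_law]). The estimator is an increasing function of K, so that its
    distribution function at lambda + x / rate is that of K at a deterministic
    threshold ([estimate_le]), and a central limit theorem for K is what is needed.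

    Let T = n Delta. Then K = N(T) - S, where S is the sum over the cells of the
    number of events beyond the first one. These are independent and have second
    moments at most (lambda Delta)^2, so that the variance of S is at most
    lambda^2 T Delta = o(T). By Chebyshev's inequality ([overcount_deviation]) the
    centred S is negligible against sqrt T, and K has the same Gaussian limit as
    N(T), with the same variance lambda ([hit_count_central_limit]). This is why
    nothing is lost with respect to the continuous observation of the flight.

    The central limit theorem for the Poisson law comes from the identity
      P(Poisson(u) <= k) = int_u^oo exp (- y) y^k / k! dy.
    In the variable y = k + sqrt k * (v / sg) the integrand, normalised to be 1 at
    its maximum, converges to exp (- v^2 / (2 sg^2)) and is dominated by an
    exponential. The integral over the whole line is known for every k, so that
    the convergence of the normalising constants follows ([cvg_poisson_cdf]).
    Squeezing, with the continuity of the normal distribution function, passes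
    from integer k to real thresholds ([poisson_central_limit]).

    Consistency follows from asymptotic normality because the rate diverges
    ([normal_consistent]). *)

(** * Elementary estimates *)

Lemma ge0_is_derive_le (R : realType) (f f' : R -> R) (a b : R) : a <= b ->
  (forall x, a <= x <= b -> is_derive x 1 f (f' x)) ->
  (forall x, a <= x <= b -> 0 <= f' x) -> f a <= f b.
Proof.
move=> ab df f'0.
have [||c cab fE] := @MVT_segment R f f' a b ab.
- move=> x xab; apply: df; move: xab.
  by rewrite in_itv/= => /andP[/ltW -> /ltW ->].
- apply: derivable_within_continuous => x xab.
  by have [] := df x xab.
- rewrite -subr_ge0 fE mulr_ge0 ?subr_ge0//; exact: f'0.
Qed.

(** Both gaps vanish at 1 and have a derivative that is a square up to a positive
    factor, so that each gives an upper bound of ln on one side of 1 and a lower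
    bound on the other. Second order precision on both sides of 1 is what lets the
    rescaled Poisson weights be compared with a Gaussian. *)
Section logarithm_bounds.
Context {R : realType}.
Implicit Types x y u : R.

Let quadratic_gap x := ln x - (x - 1) + (x - 1) ^+ 2 / 2.
Let harmonic_gap x := (x - x^-1) / 2 - ln x.

Let quadratic_gap_le x y : 0 < x -> x <= y -> quadratic_gap x <= quadratic_gap y.
Proof.
move=> x0 xy.
apply: (@ge0_is_derive_le _ _ (fun z => (z - 1) ^+ 2 / z)) => // z /andP[xz _].
  have z0 : 0 < z by exact: lt_le_trans xz.
  have dln := is_derive1_ln z0.
  rewrite /quadratic_gap; apply: is_derive_eq.
  rewrite /GRing.scale/=; field; exact: lt0r_neq0.
by rewrite divr_ge0 ?sqr_ge0// (le_trans (ltW x0)).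
Qed.

Let harmonic_gap_le x y : 0 < x -> x <= y -> harmonic_gap x <= harmonic_gap y.
Proof.
move=> x0 xy.
apply: (@ge0_is_derive_le _ _ (fun z => (1 - z^-1) ^+ 2 / 2)) => // z /andP[xz _].
  have z0 : 0 < z by exact: lt_le_trans xz.
  have zn0 : z != 0 by exact: lt0r_neq0.
  have dV : is_derive z 1 (fun w : R => w^-1) (- z ^- 2).
    have := @is_deriveV R id z 1 1 zn0 (is_derive_id _ _).
    by rewrite /GRing.scale/= mulr1.
  have dln := is_derive1_ln z0.
  rewrite /harmonic_gap; apply: is_derive_eq.
  by rewrite /GRing.scale/=; field.
by rewrite divr_ge0 ?sqr_ge0.
Qed.

Let quadratic_gap1 : quadratic_gap 1 = 0.
Proof. by rewrite /quadratic_gap ln1 subrr expr0n/= mul0r addr0 subr0. Qed.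

Let harmonic_gap1 : harmonic_gap 1 = 0.
Proof. by rewrite /harmonic_gap ln1 invr1 subrr mul0r subr0. Qed.

Lemma ln1D_bounds_ge0 u : 0 <= u ->
  u - u ^+ 2 / 2 <= ln (1 + u) <= u - u ^+ 2 / (2 * (1 + u)).
Proof.
move=> u0; have u1 : 1 <= 1 + u by rewrite lerDl.
have un0 : 1 + u != 0 by rewrite gt_eqF// (lt_le_trans ltr01).
have := quadratic_gap_le ltr01 u1; have := harmonic_gap_le ltr01 u1.
rewrite quadratic_gap1 harmonic_gap1 /quadratic_gap /harmonic_gap => h q.
apply/andP; split; first by lra.
have -> : u - u ^+ 2 / (2 * (1 + u)) = ((1 + u) - (1 + u)^-1) / 2 by field.
by lra.
Qed.

Lemma ln1D_bounds_le0 u : -1 < u -> u <= 0 ->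
  u - u ^+ 2 / (2 * (1 + u)) <= ln (1 + u) <= u - u ^+ 2 / 2.
Proof.
move=> um1 u0; have u1 : 1 + u <= 1 by rewrite gerDl.
have up : 0 < 1 + u by lra.
have un0 : 1 + u != 0 by rewrite gt_eqF.
have := quadratic_gap_le up u1; have := harmonic_gap_le up u1.
rewrite quadratic_gap1 harmonic_gap1 /quadratic_gap /harmonic_gap => h q.
apply/andP; split; last by lra.
have -> : u - u ^+ 2 / (2 * (1 + u)) = ((1 + u) - (1 + u)^-1) / 2 by field.
by lra.
Qed.

End logarithm_bounds.

Lemma cvgy_sqrt (R : realType) : (Num.sqrt x : R) @[x --> +oo] --> +oo.
Proof.
apply/cvgryPge => A; near=> x.
apply: (le_trans (ler_norm A)); rewrite -sqrtr_sqr ler_wsqrtr//.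
Unshelve. all: by end_near. Qed.

(** * The Poisson distribution function as an integral *)

Section poisson_cdf.
Context {R : realType}.
Implicit Types (u : R) (k j : nat).

Definition poisson_cdf k u : R :=
  expR (- u) * \sum_(j < k.+1) u ^+ j / j`!%:R.

Lemma poisson_cdf0 k : poisson_cdf k 0 = 1.
Proof.
rewrite /poisson_cdf oppr0 expR0 mul1r big_ord_recl/= expr0 fact0 divr1.
rewrite big1 ?addr0// => j _; by rewrite expr0n/= mul0r.
Qed.

Lemma poisson_cdfS k u :
  poisson_cdf k.+1 u = poisson_cdf k u + expR (- u) * (u ^+ k.+1 / k.+1`!%:R).
Proof. by rewrite /poisson_cdf big_ord_recr/= mulrDr. Qed.

Let is_derive_expRN u : is_derive u 1 (fun v : R => expR (- v)) (- expR (- u)).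
Proof.
rewrite -mulrN1; exact: (@is_derive1_comp _ expR (@GRing.opp R)).
Qed.

(** All terms of the sum telescope on differentiation: this is the duality
    between the Poisson and the Gamma laws. *)
Lemma is_derive_poisson_cdf k u :
  is_derive u 1 (poisson_cdf k) (- (expR (- u) * (u ^+ k / k`!%:R))).
Proof.
elim: k => [|k IH].
  rewrite (_ : poisson_cdf 0 = fun v => expR (- v)); last first.
    by apply/funext => v; rewrite /poisson_cdf big_ord_recl big_ord0 addr0 expr0
      fact0 divr1 mulr1.
  by rewrite expr0 fact0 divr1 mulr1; exact: is_derive_expRN.
rewrite (_ : poisson_cdf k.+1 =
  fun v => poisson_cdf k v + expR (- v) * (v ^+ k.+1 / k.+1`!%:R)); last first.
  by apply/funext => v; exact: poisson_cdfS.
have de := is_derive_expRN u.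
have dX : is_derive u 1 (fun v : R => v ^+ k.+1) (k.+1%:R * u ^+ k).
  apply: DeriveDef; first exact: exprn_derivable.
  by rewrite exp_derive [LHS]mulr1.
have dp : is_derive u 1 (fun v : R => v ^+ k.+1 / k.+1`!%:R) (u ^+ k / k`!%:R).
  have f0 : k`!%:R != 0 :> R by rewrite pnatr_eq0 -lt0n fact_gt0.
  have k0 : k.+1%:R != 0 :> R by rewrite pnatr_eq0.
  rewrite (_ : (fun v => _) = fun v : R => k.+1`!%:R^-1 *: v ^+ k.+1); last first.
    by apply/funext => v; rewrite /GRing.scale/= mulrC.
  apply: is_derive_eq; rewrite /GRing.scale/= factS natrM.
  by rewrite invfM mulrC -!mulrA mulrCA !mulrA mulfK// mulrC.
apply: is_derive_eq; rewrite /GRing.scale/=; ring.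
Qed.

Lemma cvgy_expRN_exp j : expR (- u) * u ^+ j @[u --> +oo] --> (0 : R).
Proof.
apply: (@squeeze_cvgr _ _ _ _ (fun=> 0) (fun u => j.+1`!%:R * u^-1)).
- near=> u.
  have u0 : 0 < u by near: u; exact: nbhs_pinfty_gt.
  rewrite mulr_ge0 ?expR_ge0 ?exprn_ge0 ?(ltW u0)//=.
  rewrite expRN ler_pdivrMl ?expR_gt0// mulrA ler_pdivlMr//.
  rewrite -exprSr -ler_pdivrMr ?ltr0n ?fact_gt0//.
  by apply: le_trans (expR_ge1Dxn j (ltW u0)); rewrite lerDr.
- exact: cvg_cst.
- rewrite -[X in _ --> X](mulr0 j.+1`!%:R); apply: cvgM; first exact: cvg_cst.
  by apply/gtr0_cvgV0; [near=> u; near: u; exact: nbhs_pinfty_gt|exact: cvg_id].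
Unshelve. all: by end_near. Qed.

Lemma cvgy_poisson_cdf k : poisson_cdf k u @[u --> +oo] --> (0 : R).
Proof.
have cvgj j : expR (- u) * (u ^+ j / j`!%:R) @[u --> +oo] --> (0 : R).
  rewrite -(mul0r (j`!%:R^-1)); under eq_fun do rewrite mulrA.
  by apply: cvgM; [exact: cvgy_expRN_exp|exact: cvg_cst].
elim: k => [|k IH].
  rewrite (_ : poisson_cdf 0 = fun u => expR (- u) * (u ^+ 0 / 0`!%:R))//.
  by apply/funext => u; rewrite /poisson_cdf big_ord_recl big_ord0 addr0.
rewrite -(addr0 0) (_ : poisson_cdf k.+1 =
  fun u => poisson_cdf k u + expR (- u) * (u ^+ k.+1 / k.+1`!%:R)); last first.
  by apply/funext => u; exact: poisson_cdfS.
exact: cvgD.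
Qed.

Lemma poisson_cdf_le k u v : 0 <= u -> u <= v ->
  poisson_cdf k v <= poisson_cdf k u.
Proof.
move=> u0 uv; rewrite -lerN2.
apply: (@ge0_is_derive_le _ (fun w => - poisson_cdf k w)
  (fun w => expR (- w) * (w ^+ k / k`!%:R))) => // w /andP[uw _].
  have dw := is_derive_poisson_cdf k w.
  by rewrite -[X in is_derive _ _ _ X]opprK; exact: is_deriveN.
by rewrite mulr_ge0 ?expR_ge0// divr_ge0// exprn_ge0// (le_trans u0).
Qed.

End poisson_cdf.

Section poisson_kernel.
Context {R : realType} (sg : R).
Hypothesis sg_gt0 : 0 < sg.
Implicit Types (k : nat) (a v w : R).
Notation mu := (@lebesgue_measure R).

(** This is the Gamma integrand exp (- y) y ^ k, read at
    y = k + sqrt k * (v / sg) and normalised to be 1 at its maximum v = 0. The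
    scale sg lets the limit be the normal density of standard deviation sg. *)
Definition poisson_kernel k v : R :=
  (1 + v / sg / Num.sqrt k%:R) ^+ k * expR (- (Num.sqrt k%:R * (v / sg))).

Lemma poisson_kernel_ge0 k v : (0 < k)%N -> - (sg * Num.sqrt k%:R) <= v ->
  0 <= poisson_kernel k v.
Proof.
move=> k0 kv; rewrite mulr_ge0 ?expR_ge0// exprn_ge0//.
rewrite -mulrA -invfM -lerBlDl sub0r ler_pdivlMr ?mulN1r//.
by rewrite mulr_gt0// sqrtr_gt0 ltr0n.
Qed.

Lemma continuous_poisson_kernel k : continuous (poisson_kernel k).
Proof.
move=> v; apply: (@continuousM _ _ (fun v => (1 + v / sg / Num.sqrt k%:R) ^+ k)
  (fun v => expR (- (Num.sqrt k%:R * (v / sg))))).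
  apply: (@continuous_comp _ _ _ (fun v => 1 + v / sg / Num.sqrt k%:R)
    (fun x : R => x ^+ k)); last exact: exprn_continuous.
  apply: cvgD; first exact: cvg_cst.
  by do 2 (apply: cvgM; last exact: cvg_cst).
apply: (@continuous_comp _ _ _ (fun v => - (Num.sqrt k%:R * (v / sg))) expR);
  last exact: continuous_expR.
apply: cvgN; apply: cvgM; first exact: cvg_cst.
by apply: cvgM; last exact: cvg_cst.
Qed.

(** The density at v = 0 of the Gamma law in the variable v. *)
Definition poisson_peak k : R :=
  Num.sqrt k%:R / sg * (expR (- k%:R) * (k%:R ^+ k / k`!%:R)).

Lemma poisson_peak_gt0 k : (0 < k)%N -> 0 < poisson_peak k.
Proof.
move=> k0; rewrite /poisson_peak !mulr_gt0 ?invr_gt0 ?expR_gt0//.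
- by rewrite sqrtr_gt0 ltr0n.
- by rewrite exprn_gt0// ltr0n.
Qed.

(** Integrates the derivative of the distribution function along
    y = k + sqrt k * (v / sg). The lower bound on a says that y >= 0. *)
Lemma integral_poisson_kernel k a : (0 < k)%N -> - (sg * Num.sqrt k%:R) <= a ->
  (\int[mu]_(v in `[a, +oo[) (poisson_kernel k v)%:E =
   (poisson_cdf k (k%:R + Num.sqrt k%:R * (a / sg)) / poisson_peak k)%:E)%E.
Proof.
move=> k0 ka.
have sk0 : 0 < Num.sqrt k%:R :> R by rewrite sqrtr_gt0 ltr0n.
have p0 := poisson_peak_gt0 k0.
pose H v := - (poisson_cdf k (k%:R + Num.sqrt k%:R * (v / sg)) / poisson_peak k).
have dH v : is_derive v 1 H (poisson_kernel k v).
  pose y := k%:R + Num.sqrt k%:R * (v / sg).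
  have dy : is_derive v 1 (fun v => k%:R + Num.sqrt k%:R * (v / sg))
      (Num.sqrt k%:R / sg).
    by apply: is_derive_eq; rewrite /GRing.scale/=; ring.
  have dc := is_derive_poisson_cdf k y.
  have dyc := @is_derive1_comp R (poisson_cdf k)
    (fun v => k%:R + Num.sqrt k%:R * (v / sg)) v _ _ dc dy.
  have -> : H = fun v => (- (poisson_peak k)^-1) *:
     (poisson_cdf k \o (fun v => k%:R + Num.sqrt k%:R * (v / sg))) v.
    by apply/funext => z; rewrite /H/= /GRing.scale/= mulNr mulrC.
  apply: is_derive_eq.
  have kE : k%:R * (v / sg / Num.sqrt k%:R) = Num.sqrt k%:R * (v / sg).
    rewrite mulrCA -[X in X / Num.sqrt _](@sqr_sqrtr _ k%:R)// expr2.
    by rewrite mulfK ?gt_eqF// mulrC.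
  have yE : y ^+ k = k%:R ^+ k * (1 + v / sg / Num.sqrt k%:R) ^+ k.
    by rewrite -exprMn mulrDr mulr1 kE.
  have eE : expR (- y) = expR (- k%:R) * expR (- (Num.sqrt k%:R * (v / sg))).
    by rewrite -expRD -opprD.
  rewrite /GRing.scale/= yE eE /poisson_kernel /poisson_peak; field.
  by rewrite !gt_eqF ?expR_gt0 ?exprn_gt0 ?ltr0n ?fact_gt0.
rewrite (@ge0_continuous_FTC2y _ _ H _ 0).
- by rewrite EFinN oppeK add0e.
- move=> x ax; apply: poisson_kernel_ge0 => //; exact: le_trans ax.
- by apply: continuous_subspaceT; exact: continuous_poisson_kernel.
- rewrite /H -oppr0 -(mul0r (poisson_peak k)^-1).
  apply: cvgN; apply: cvgM; last exact: cvg_cst.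
  apply: (@cvg_comp _ _ _ (fun x => k%:R + Num.sqrt k%:R * (x / sg)) (poisson_cdf k)
     _ (pinfty_nbhs R)); last exact: cvgy_poisson_cdf.
  apply: (@cvg_comp _ _ _ (fun x => Num.sqrt k%:R * (x / sg))
    (fun y => k%:R + y) _ (pinfty_nbhs R)); last exact: cvg_addrl.
  by apply: gt0_cvgMry => //; apply: gt0_cvgMly; rewrite ?invr_gt0.
- by move=> x _; have [] := dH x.
- apply: cvg_at_right_filter; have [d1 _] := dH a.
  by apply: differentiable_continuous; exact/derivable1_diffP.
- by move=> x _; rewrite derive1E; have [_ ->] := dH x.
Qed.

End poisson_kernel.

(** * Gaussian limit of the rescaled integrand *)

Section poisson_kernel_limit.
Context {R : realType} (sg : R).
Hypothesis sg_gt0 : 0 < sg.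
Implicit Types (k : nat) (a v w : R).
Notation mu := (@lebesgue_measure R).
Local Notation g := (poisson_kernel sg).

Let sqrt_gt0 k : (0 < k)%N -> 0 < Num.sqrt k%:R :> R.
Proof. by move=> k0; rewrite sqrtr_gt0 ltr0n. Qed.

Let lt_normalized k v : (0 < k)%N -> - (sg * Num.sqrt k%:R) < v ->
  -1 < v / sg / Num.sqrt k%:R.
Proof.
move=> k0 kv.
rewrite -mulrA -invfM ltr_pdivlMr ?mulN1r//.
by rewrite mulr_gt0// sqrt_gt0.
Qed.

Lemma poisson_kernelE k v : (0 < k)%N -> - (sg * Num.sqrt k%:R) < v ->
  g k v = expR (k%:R * ln (1 + v / sg / Num.sqrt k%:R)
                - Num.sqrt k%:R * (v / sg)).
Proof.
move=> k0 kv.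
have p0 : 0 < 1 + v / sg / Num.sqrt k%:R by have := lt_normalized k0 kv; lra.
rewrite /poisson_kernel expRD; congr (_ * _).
by rewrite mulr_natl -lnXn// lnK// posrE exprn_gt0.
Qed.

(** Taking w / sqrt k for u in the second order bounds of ln (1 + u): the linear
    terms cancel and only the quadratic ones remain. The two bounds change sides
    with the sign of v. *)
Lemma poisson_kernel_bounds k v : (0 < k)%N -> - (sg * Num.sqrt k%:R) < v ->
  let w := v / sg in
  let damped := expR (- (w ^+ 2 / (2 * (1 + w / Num.sqrt k%:R)))) in
  let gauss := expR (- (w ^+ 2 / 2)) in
  (0 <= v -> gauss <= g k v <= damped) /\ (v <= 0 -> damped <= g k v <= gauss).
Proof.
move=> k0 kv w damped gauss; rewrite poisson_kernelE//.
have s0 := sqrt_gt0 k0.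
have kE : k%:R = Num.sqrt k%:R ^+ 2 :> R by rewrite sqr_sqrtr.
have u1 := lt_normalized k0 kv.
rewrite -/w in u1 *; set s := Num.sqrt k%:R in s0 kE u1 *.
have d0 : 1 + w / s != 0 by rewrite gt_eqF//; lra.
have sn0 : s != 0 by rewrite gt_eqF.
have gaussE : - (w ^+ 2 / 2) = k%:R * (w / s - (w / s) ^+ 2 / 2) - s * w.
  by rewrite kE; field.
have dampedE : - (w ^+ 2 / (2 * (1 + w / s))) =
    k%:R * (w / s - (w / s) ^+ 2 / (2 * (1 + w / s))) - s * w.
  rewrite kE; field; rewrite sn0/=.
  apply: contra d0 => /eqP e; apply/eqP.
  by rewrite -[1](@divff _ s)// -mulrDl e mul0r.
rewrite /damped /gauss gaussE dampedE; split=> v0; rewrite !ler_expR !lerD2r !ler_pM2l ?ltr0n//.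
- by apply: ln1D_bounds_ge0; rewrite !divr_ge0// ltW.
- apply: ln1D_bounds_le0 => //.
  by rewrite mulr_le0_ge0 ?invr_ge0 ?(ltW s0)// mulr_le0_ge0// invr_ge0 ltW.
Qed.

(** The integrable bound for dominated convergence. For v >= 0 only the damped
    exponent is available; as sqrt k >= 1 it is at most - w^2 / (2 (1 + w)), which
    decays like - w / 2. *)
Lemma poisson_kernel_le k v : (0 < k)%N -> - (sg * Num.sqrt k%:R) < v ->
  g k v <= expR 2^-1 * expR (- (2 * sg)^-1 * `|v|).
Proof.
move=> k0 kv; rewrite -expRD.
have [h1 h2] := poisson_kernel_bounds k0 kv.
have s1 : 1 <= Num.sqrt k%:R :> R by rewrite -[leLHS]sqrtr1 ler_sqrt ?ler1n.
have s0 := sqrt_gt0 k0.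
have wE : (2 * sg)^-1 * `|v| = `|v / sg| / 2.
  by rewrite normrM (@gtr0_norm _ sg^-1) ?invr_gt0//; field; rewrite gt_eqF.
rewrite mulNr wE; set w := v / sg in h1 h2 *.
have [v0|/ltW v0] := leP 0 v.
- have w0 : 0 <= w by rewrite divr_ge0// ltW.
  have /andP[_] := h1 v0; move/le_trans; apply; rewrite ler_expR.
  rewrite ger0_norm//.
  have : w / Num.sqrt k%:R <= w by rewrite ler_pdivrMr// ler_peMr.
  set u := w / _ => uw.
  have u0 : 0 <= u by rewrite divr_ge0// ltW.
  apply: (@le_trans _ _ (- (w ^+ 2 / (2 * (1 + w))))).
    rewrite lerN2 ler_wpM2l ?sqr_ge0// lef_pV2 ?posrE; lra.
  rewrite lerNl ler_pdivlMr; last lra.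
  by nra.
- have /andP[_] := h2 v0; move/le_trans; apply; rewrite ler_expR.
  have := sqr_ge0 (`|w| - 1); rewrite -[w ^+ 2]real_normK ?num_real//; nra.
Qed.

Lemma cvg_poisson_kernel v :
  g k v @[k --> \oo] --> expR (- ((v / sg) ^+ 2 / 2)).
Proof.
have sq : (Num.sqrt k%:R : R) @[k --> \oo] --> +oo.
  exact: (cvg_comp _ _ (@cvgr_idn R) (@cvgy_sqrt R)).
have iv : ((Num.sqrt k%:R)^-1 : R) @[k --> \oo] --> (0 : R).
  apply/gtr0_cvgV0 => //; near=> k; apply: sqrt_gt0.
  by near: k; exact: nbhs_infty_gt.
have lo : expR (- ((v / sg) ^+ 2 / (2 * (1 + v / sg / Num.sqrt k%:R)))) @[k --> \oo]
    --> expR (- ((v / sg) ^+ 2 / 2)).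
  apply: continuous_cvg; first exact: continuous_expR.
  apply: cvgN; apply: cvgM; first exact: cvg_cst.
  apply: cvgV => //.
  rewrite -[X in _ --> X]mulr1; apply: cvgM; first exact: cvg_cst.
  rewrite -[X in _ --> X]addr0; apply: cvgD; first exact: cvg_cst.
  by rewrite -(mulr0 (v / sg)); apply: cvgM => //; exact: cvg_cst.
have big : \forall k \near \oo, - (sg * Num.sqrt k%:R) < v.
  move/cvgryPgt : sq => /(_ (- v / sg)); apply: filterS => k.
  by rewrite ltr_pdivrMr// mulrC ltrNl.
have [v0|/ltW v0] := leP 0 v.
- apply: (squeeze_cvgr _ (cvg_cst (expR (- ((v / sg) ^+ 2 / 2)))) lo).
  near=> k.
  have k0 : (0 < k)%N by near: k; exact: nbhs_infty_gt.
  have kv : - (sg * Num.sqrt k%:R) < v by near: k.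
  by have [+ _] := poisson_kernel_bounds k0 kv; exact.
- apply: (squeeze_cvgr _ lo (cvg_cst (expR (- ((v / sg) ^+ 2 / 2))))).
  near=> k.
  have k0 : (0 < k)%N by near: k; exact: nbhs_infty_gt.
  have kv : - (sg * Num.sqrt k%:R) < v by near: k.
  by have [_] := poisson_kernel_bounds k0 kv; exact.
Unshelve. all: by end_near. Qed.

End poisson_kernel_limit.

Lemma integrable_expRN_norm (R : realType) (b : R) : 0 < b ->
  (@lebesgue_measure R).-integrable setT (EFin \o (fun v => expR (- b * `|v|))).
Proof.
move=> b0.
have cf : continuous (fun v : R => expR (- b * `|v|)).
  move=> v; apply: (@continuous_comp _ _ _ (fun v => - b * `|v|) expR);
    last exact: continuous_expR.
  by apply: cvgM; [exact: cvg_cst|exact: norm_continuous].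
have mf : measurable_fun [set: R] (EFin \o (fun v : R => expR (- b * `|v|))).
  by apply/measurable_EFinP; exact: continuous_measurable_fun.
apply/integrableP; split => //.
under eq_integral do rewrite /= ger0_norm ?expR_ge0//.
have symf : (fun v : R => expR (- b * `|v|)) =1 (fun v => expR (- b * `|v|)) \o -%R.
  by move=> x; rewrite /= normrN.
rewrite (ge0_symfun_integralT (fun v => expR_ge0 _) cf symf).
apply: (@le_lt_trans _ _ (2%:E * (b^-1%:E *
    \int[lebesgue_measure]_x (exponential_pdf b x)%:E))%E); last first.
  by rewrite integral_exponential_pdf// mule1 -EFinM ltry.
have mE : measurable_fun [set: R] (fun x => (exponential_pdf b x)%:E).
  by apply/measurable_EFinP; exact: measurable_exponential_pdf.
have E0 x : [set: R] x -> (0%R <= (exponential_pdf b x)%:E)%E.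
  by rewrite lee_fin exponential_pdf_ge0// ltW.
rewrite lee_pmul2l// -ge0_integralZl//; last first.
  by rewrite lee_fin invr_ge0 ltW.
rewrite -set_itvcy [leLHS]integral_mkcond; apply: ge0_le_integral => //=.
- move=> x _; rewrite patchE; case: ifPn => // _; rewrite lee_fin expR_ge0//.
- by apply/(measurable_restrictT _ _).1 => //; exact: measurable_funS mf.
- apply/measurable_EFinP; apply: measurable_funM => //.
  exact: measurable_exponential_pdf.
- move=> x _; rewrite patchE; case: ifPn => [|_]; last first.
    by rewrite lee_fin mulr_ge0 ?invr_ge0 ?exponential_pdf_ge0// ltW.
  rewrite inE/= in_itv/= andbT => x0.
  rewrite -EFinM exponential_pdfE// mulrA mulVf ?gt_eqF// mul1r.
  by rewrite lee_fin ger0_norm.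
Qed.

Section poisson_gauss.
Context {R : realType} (sg : R).
Hypothesis sg_gt0 : 0 < sg.
Implicit Types (k : nat) (a v w : R).
Notation mu := (@lebesgue_measure R).

(** The kernel is cut at the point where y = 0 and scaled by the height of the
    normal density, so that its pointwise limit is that density. *)
Let h k v : R :=
  if - (sg * Num.sqrt k%:R) < v then normal_peak sg * poisson_kernel sg k v else 0.

Let measurable_h k : measurable_fun [set: R] (h k).
Proof.
apply: measurable_fun_if => //; first exact: measurable_fun_ltr.
apply: measurable_funTS; apply: measurable_funM => //.
by apply: continuous_measurable_fun; exact: continuous_poisson_kernel.
Qed.

Let cvg_integral_h (D : set R) : measurable D ->
  (\int[mu]_(v in D) (h k.+1 v)%:E @[k --> \oo] --> normal_prob 0 sg D)%E.
Proof.
move=> mD.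
pose G v := normal_peak sg * expR 2^-1 * expR (- (2 * sg)^-1 * `|v|).
have sn0 : sg != 0 by rewrite gt_eqF.
have mh k := measurable_h k.
have mn := @measurable_normal_pdf R 0 sg.
have [] := @dominated_convergence _ _ _ mu D mD (fun k v => (h k.+1 v)%:E)
  (fun v => (normal_pdf 0 sg v)%:E) (EFin \o G); last by [].
- by move=> k; apply/measurable_EFinP; apply: measurable_funTS; exact: mh.
- apply/measurable_EFinP; apply: measurable_funTS; exact: mn.
- apply: aeW => v _; apply: cvg_EFin; first exact: nearW.
  rewrite normal_pdfE//= /normal_fun.
  rewrite (_ : - _ / _ = - ((v / sg) ^+ 2 / 2)); last first.
    by rewrite subr0 -mulr_natr; field.
  have := @cvg_poisson_kernel _ _ sg_gt0 v.
  rewrite -(cvg_shiftS (fun k => poisson_kernel sg k v)) => cg.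
  have : normal_peak sg * poisson_kernel sg k.+1 v @[k --> \oo] -->
      normal_peak sg * expR (- ((v / sg) ^+ 2 / 2)).
    by apply: cvgM => //; exact: cvg_cst.
  apply: cvg_trans; apply: near_eq_cvg.
  have /cvgryPgt/(_ (- v / sg)) : (Num.sqrt (k.+1)%:R : R) @[k --> \oo] --> +oo.
    rewrite (cvg_shiftS (fun k => Num.sqrt k%:R : R)).
    exact: (cvg_comp _ _ (@cvgr_idn R) (@cvgy_sqrt R)).
  apply: filterS => k; rewrite ltr_pdivrMr// mulrC ltrNl /h => hk.
  by rewrite /= hk.
- apply: (@integrableS _ _ _ mu setT) => //.
  rewrite (_ : EFin \o G = fun v => ((normal_peak sg * expR 2^-1)%:E *
     (EFin \o (fun v => expR (- (2 * sg)^-1 * `|v|)%R)) v)%E)//.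
  apply: integrableZl => //; apply: integrable_expRN_norm.
  by rewrite invr_gt0 mulr_gt0.
- apply: aeW => v k _ /=; rewrite lee_fin /h; case: ifPn => kv; last first.
    by rewrite normr0 /G !mulr_ge0 ?normal_peak_ge0 ?expR_ge0.
  rewrite ger0_norm; last first.
    by rewrite mulr_ge0 ?normal_peak_ge0// poisson_kernel_ge0// ltW.
  by rewrite /G -mulrA ler_wpM2l ?normal_peak_ge0// poisson_kernel_le.
Qed.

Let integral_h k a : (0 < k)%N -> - (sg * Num.sqrt k%:R) <= a ->
  (\int[mu]_(v in `[a, +oo[) (h k v)%:E =
   (normal_peak sg * (poisson_cdf k (k%:R + Num.sqrt k%:R * (a / sg))
      / poisson_peak sg k))%:E)%E.
Proof.
move=> k0 ka; rewrite EFinM -integral_poisson_kernel//.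
rewrite -[LHS]integral_itv_obnd_cbnd; last first.
  by apply/measurable_EFinP; apply: measurable_funTS.
rewrite -[X in (_ * X)%E]integral_itv_obnd_cbnd; last first.
  apply/measurable_EFinP; apply: measurable_funTS.
  by apply: continuous_measurable_fun; exact: continuous_poisson_kernel.
rewrite -ge0_integralZl//=.
- apply: eq_integral => v; rewrite inE/= in_itv/= andbT => av.
  by rewrite /h (le_lt_trans ka av) EFinM.
- apply/measurable_EFinP; apply: measurable_funTS.
  by apply: continuous_measurable_fun; exact: continuous_poisson_kernel.
- move=> v; rewrite /= in_itv/= andbT => av; rewrite lee_fin.
  by rewrite poisson_kernel_ge0// (le_trans ka)// ltW.
- by rewrite lee_fin normal_peak_ge0.
Qed.

Let integral_hT k : (0 < k)%N ->
  (\int[mu]_v (h k v)%:E = (normal_peak sg / poisson_peak sg k)%:E)%E.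
Proof.
move=> k0; set c := - (sg * Num.sqrt k%:R).
have := integral_h k0 (lexx c).
have -> : k%:R + Num.sqrt k%:R * (c / sg) = 0.
  rewrite /c mulNr mulrN [sg * _]mulrC mulfK ?gt_eqF// -expr2 sqr_sqrtr//.
  by rewrite subrr.
rewrite poisson_cdf0 mul1r => <-; rewrite [RHS]integral_mkcond.
apply: eq_integral => v _; rewrite patchE; case: ifPn => //.
by rewrite notin_setE/= in_itv/= andbT /h -/c => /negP; case: ltP => // /ltW ->.
Qed.

(** The integral over the whole line converges to 1, hence the ratio r of the
    two peaks does; the normalising constant comes out without Stirling's formula. *)
Lemma cvg_poisson_cdf a :
  (poisson_cdf k (k%:R + Num.sqrt k%:R * (a / sg)))%:E @[k --> \oo]
  --> normal_prob 0 sg `[a, +oo[.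
Proof.
have sn0 : sg != 0 by rewrite gt_eqF.
pose r k := normal_peak sg / poisson_peak sg k.
pose F k := poisson_cdf k (k%:R + Num.sqrt k%:R * (a / sg)).
pose L := fine (normal_prob 0 sg `[a, +oo[).
have LE : normal_prob 0 sg `[a, +oo[ = L%:E.
  by rewrite /L fineK// fin_num_measure.
have p0 k : r k.+1 != 0.
  by rewrite mulf_neq0 ?gt_eqF ?normal_peak_gt0 ?invr_gt0 ?poisson_peak_gt0.
have r1 : r k.+1 @[k --> \oo] --> (1 : R).
  suff /fine_cvg : (r k.+1)%:E @[k --> \oo] --> (1%:E : \bar R) by [].
  have := @cvg_integral_h setT measurableT.
  rewrite [normal_prob _ _ _]probability_setT; apply: cvg_trans.
  by apply: near_eq_cvg; near=> k; rewrite integral_hT.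
have rF : r k.+1 * F k.+1 @[k --> \oo] --> L.
  suff /fine_cvg : (r k.+1 * F k.+1)%:E @[k --> \oo] --> (L%:E : \bar R) by [].
  have := @cvg_integral_h `[a, +oo[%classic (measurable_itv _).
  rewrite LE; apply: cvg_trans.
  apply: near_eq_cvg; near=> k; rewrite integral_h//.
    by rewrite /r /F mulrA mulrAC.
  near: k.
  have : (Num.sqrt (k.+1)%:R : R) @[k --> \oo] --> +oo.
    rewrite (cvg_shiftS (fun k => Num.sqrt k%:R : R)).
    exact: (cvg_comp _ _ (@cvgr_idn R) (@cvgy_sqrt R)).
  move=> /cvgryPge/(_ (- a / sg)); apply: filterS => k.
  by rewrite ler_pdivrMr// mulrC lerNl.
rewrite LE -(cvg_shiftS (fun k => (F k)%:E)).
apply: cvg_EFin; first exact: nearW.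
have : (r k.+1)^-1 * (r k.+1 * F k.+1) @[k --> \oo] --> 1^-1 * L.
  by apply: cvgM => //; apply: cvgV.
rewrite invr1 mul1r; apply: cvg_trans; apply: near_eq_cvg; near=> k.
by rewrite mulKf.
Unshelve. all: by end_near. Qed.

End poisson_gauss.

(** * Central limit theorem for the Poisson law *)

Section normal_distribution_function.
Context {R : realType} (sg : R).
Hypothesis sg_gt0 : 0 < sg.
Implicit Types x y : R.
Notation mu := (@lebesgue_measure R).

Lemma normal_prob_tail_sym x :
  normal_prob 0 sg `[- x, +oo[ = normal_prob 0 sg `]-oo, x].
Proof.
have sn0 : sg != 0 by rewrite gt_eqF.
rewrite /normal_prob -{2}(opprK x) ge0_integration_by_substitutionNy.
- apply: eq_integral => v _; congr EFin; rewrite !normal_pdfE//= /normal_fun/=.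
  by rewrite !subr0 sqrrN.
- by apply: continuous_subspaceT; exact: continuous_normal_pdf.
- by move=> v _; exact: normal_pdf_ge0.
Qed.

Definition normal_cdf x : R := fine (normal_prob 0 sg `]-oo, x]).

Lemma normal_cdfE x : normal_prob 0 sg `]-oo, x] = (normal_cdf x)%:E.
Proof. by rewrite /normal_cdf fineK// fin_num_measure. Qed.

Lemma normal_cdf_lipschitz x y : x <= y ->
  normal_cdf x <= normal_cdf y <= normal_cdf x + normal_peak sg * (y - x).
Proof.
have sn0 : sg != 0 by rewrite gt_eqF.
move=> xy; rewrite -!lee_fin EFinD -!normal_cdfE.
have -> : [set` `]-oo, y]] = `]-oo, x]%classic `|` `]x, y]%classic.
  by rewrite -itv_bndbnd_setU// ?bnd_simp.
rewrite measureU//=; last first.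
  apply/seteqP; split=> // z [] /=; rewrite !in_itv/= => zx /andP[xz _].
  by move: (lt_le_trans xz zx); rewrite ltxx.
apply/andP; split; first by rewrite leeDl.
rewrite leeD2l//.
apply: (@le_trans _ _ (\int[mu]_(v in `]x, y]) (normal_peak sg)%:E)%E).
  apply: ge0_le_integral => //=.
  - by move=> v _; rewrite lee_fin normal_pdf_ge0.
  - apply/measurable_EFinP; apply: measurable_funTS.
    exact: measurable_normal_pdf.
  - by move=> v _; rewrite lee_fin normal_pdf_ub.
rewrite integral_cst//= lebesgue_measure_itv/= lte_fin.
case: ifPn => _; first by rewrite -EFinB -EFinM.
by rewrite mule0 lee_fin mulr_ge0 ?normal_peak_ge0 ?subr_ge0.
Qed.

(** Bounds shifted by an arbitrary e suffice because the normal distribution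
    function is continuous. This absorbs both the rounding of a real threshold to
    an integer and an error term that is negligible in probability. *)
Lemma squeeze_normal_cdf (I : Type) (F : set_system I) {FF : ProperFilter F}
  (f : I -> \bar R) x :
  (forall e, 0 < e -> exists lo hi : I -> \bar R,
    [/\ lo i @[i --> F] --> normal_prob 0 sg `]-oo, x - e],
        hi i @[i --> F] --> normal_prob 0 sg `]-oo, x + e]
      & \forall i \near F, (lo i <= f i <= hi i)%E]) ->
  f i @[i --> F] --> normal_prob 0 sg `]-oo, x].
Proof.
move=> H; have sn0 : sg != 0 by rewrite gt_eqF.
have p0 : 0 < normal_peak sg by exact: normal_peak_gt0.
suff key d : 0 < d -> \forall i \near F,
    ((normal_cdf x - d)%:E <= f i <= (normal_cdf x + d)%:E)%E.
  have ffin : \forall i \near F, f i \is a fin_num.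
    apply: filterS (key _ ltr01) => i /andP[l u].
    by rewrite fin_numE -ltNye -ltey (lt_le_trans _ l) ?ltNyr//= (le_lt_trans u) ?ltry.
  rewrite normal_cdfE; apply: cvg_EFin => //; apply/cvgrPdist_le => d d0.
  near=> i.
  have fi : f i \is a fin_num by near: i.
  have : ((normal_cdf x - d)%:E <= f i <= (normal_cdf x + d)%:E)%E.
    by near: i; exact: key.
  rewrite -[f i]fineK// !lee_fin /= => /andP[l u].
  by rewrite ler_distlC; apply/andP.
move=> d0; pose e := d / 2 / normal_peak sg.
have e0 : 0 < e by rewrite !divr_gt0.
have eE : normal_peak sg * e = d / 2 by rewrite /e mulrC divfK ?gt_eqF.
have [lo [hi [cl ch lh]]] := H e e0.
have /andP[_] : normal_cdf (x - e) <= normal_cdf x <= normal_cdf (x - e) + d / 2.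
  by have /normal_cdf_lipschitz : x - e <= x by [lra]; rewrite subKr eE.
have /andP[_] : normal_cdf x <= normal_cdf (x + e) <= normal_cdf x + d / 2.
  by have /normal_cdf_lipschitz : x <= x + e by [lra]; rewrite (_ : x + e - x = e) ?eE//; ring.
move=> b1 b2.
rewrite !normal_cdfE in cl ch.
move/fine_cvgP : cl => [lfin /cvgrPdist_le cl].
move/fine_cvgP : ch => [hfin /cvgrPdist_le ch].
have d20 : 0 < d / 2 by rewrite divr_gt0.
near=> i.
have /andP[lf fh] : (lo i <= f i <= hi i)%E by near: i.
have li : lo i \is a fin_num by near: i.
have hi' : hi i \is a fin_num by near: i.
have : `|normal_cdf (x - e) - fine (lo i)| <= d / 2 by near: i; exact: cl.
have : `|normal_cdf (x + e) - fine (hi i)| <= d / 2 by near: i; exact: ch.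
rewrite !ler_distlC => /andP[_ h1] /andP[h2 _].
apply/andP; split.
- by apply: le_trans lf; rewrite -[lo i]fineK// lee_fin; lra.
- by apply: (le_trans fh); rewrite -[hi i]fineK// lee_fin; lra.
Unshelve. all: by end_near. Qed.

End normal_distribution_function.

Lemma poisson_prob1 (R : realType) (u : R) (k : nat) : 0 < u ->
  poisson_prob u 0 [set k] = (expR (- u) * (u ^+ k / k`!%:R))%:E.
Proof.
move=> u0; rewrite /poisson_prob u0 esum_set1 ?lee_fin ?poisson_pmf_ge0//.
by rewrite /poisson_pmf u0 mulrC.
Qed.

Lemma poisson_prob_le (R : realType) (u : R) (k : nat) : 0 <= u ->
  poisson_prob u 0 [set j | (j <= k)%N] = (poisson_cdf k u)%:E.
Proof.
rewrite le_eqVlt => /predU1P[<-|u0].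
  by rewrite /poisson_prob ltxx poisson_cdf0 diracE mem_set.
elim: k => [|k IH].
  rewrite (_ : [set j | _] = [set 0%N]); last first.
    by apply/seteqP; split => j /=; [rewrite leqn0 => /eqP|move->].
  by rewrite poisson_prob1// /poisson_cdf big_ord_recl big_ord0 addr0.
rewrite (_ : [set j | _] = [set j | (j <= k)%N] `|` [set k.+1]); last first.
  apply/seteqP; split => j /=; rewrite [(_ <= k.+1)%N]leq_eqVlt ltnS.
    by case/orP=> [/eqP|]; [right|left].
  by case=> [->|->]; rewrite ?orbT ?eqxx.
rewrite measureU//=; last first.
  by apply/seteqP; split=> // j [] /= + jE; rewrite jE ltnn.
by rewrite IH poisson_prob1// poisson_cdfS EFinD.
Qed.

Section poisson_central_limit.
Context {R : realType} (rate : R).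
Hypothesis rate_gt0 : 0 < rate.
Local Notation sg := (Num.sqrt rate).

Let sg_gt0 : 0 < sg. Proof. by rewrite sqrtr_gt0. Qed.

Let thr (x t : R) := rate * t + x * Num.sqrt t.

Let near_thr_ge0 (x : R) : \forall t \near +oo, 0 <= thr x t.
Proof.
near=> t.
have t0 : 0 < t by near: t; exact: nbhs_pinfty_gt.
have -> : thr x t = Num.sqrt t * (rate * Num.sqrt t + x).
  by rewrite /thr -{1}[t]sqr_sqrtr ?(ltW t0)//; ring.
rewrite mulr_ge0// -lerBlDr sub0r -ler_pdivrMl//.
near: t; have /cvgryPge := @cvgy_sqrt R; exact.
Unshelve. all: by end_near. Qed.

Let cvg_deviation (x : R) :
  (rate * t - (Num.truncn (thr x t))%:R) / Num.sqrt t @[t --> +oo] --> - x.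
Proof.
apply: (@squeeze_cvgr _ _ _ _ (fun=> - x) (fun t => - x + (Num.sqrt t)^-1)).
- near=> t.
  have t0 : 0 < t by near: t; exact: nbhs_pinfty_gt.
  have s0 : 0 < Num.sqrt t by rewrite sqrtr_gt0.
  have /truncn_itv : 0 <= thr x t by near: t; exact: near_thr_ge0.
  rewrite -natr1 => /andP[]; rewrite {2 3}/thr.
  set k : R := _%:R => h1 h2.
  rewrite ler_pdivlMr// ler_pdivrMr// mulrDl mulVf ?gt_eqF//.
  by apply/andP; split; lra.
- exact: cvg_cst.
- rewrite -[X in _ --> X]addr0; apply: cvgD; first exact: cvg_cst.
  apply/gtr0_cvgV0; last exact: cvgy_sqrt.
  by near=> t; rewrite sqrtr_gt0; near: t; exact: nbhs_pinfty_gt.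
Unshelve. all: by end_near. Qed.

Let cvg_sqrt_ratio (x : R) :
  Num.sqrt (Num.truncn (thr x t))%:R / Num.sqrt t @[t --> +oo] --> sg.
Proof.
have iv : (Num.sqrt t)^-1 @[t --> +oo] --> (0 : R).
  apply/gtr0_cvgV0; last exact: cvgy_sqrt.
  by near=> t; rewrite sqrtr_gt0; near: t; exact: nbhs_pinfty_gt.
have c : rate - ((rate * t - (Num.truncn (thr x t))%:R) / Num.sqrt t)
      * (Num.sqrt t)^-1 @[t --> +oo] --> rate.
  rewrite -[X in _ --> X]subr0; apply: cvgB; first exact: cvg_cst.
  by rewrite -(mulr0 (- x)); apply: cvgM => //; exact: cvg_deviation.
have := cvg_comp _ _ c (@sqrt_continuous R rate).
apply: cvg_trans; apply: near_eq_cvg; near=> t.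
have t0 : 0 < t by near: t; exact: nbhs_pinfty_gt.
rewrite /= -mulrA -invfM -expr2 sqr_sqrtr ?(ltW t0)// mulrBl mulfK ?gt_eqF//.
by rewrite subKr sqrtrM// sqrtrV// ltW.
Unshelve. all: by end_near. Qed.

Let cvg_truncn (x : R) : Num.truncn (thr x t) @[t --> +oo] --> \oo.
Proof.
apply/(@cvgrnyP R); apply/cvgryPge => A; near=> t.
have t0 : 0 < t by near: t; exact: nbhs_pinfty_gt.
have s0 : 0 < Num.sqrt t by rewrite sqrtr_gt0.
have h : sg / 2 < Num.sqrt (Num.truncn (thr x t))%:R / Num.sqrt t.
  near: t; apply: (cvgr_gt sg); first exact: cvg_sqrt_ratio.
  by have := sg_gt0; lra.
have h2 : 1 + `|A| <= sg / 2 * Num.sqrt t.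
  rewrite mulrC -ler_pdivrMr ?divr_gt0//.
  by near: t; have /cvgryPge := @cvgy_sqrt R; exact.
move: h; rewrite ltr_pdivlMr// => h3.
set q := Num.sqrt (Num.truncn _)%:R in h3.
have -> : (Num.truncn (thr x t))%:R = q ^+ 2 :> R by rewrite sqr_sqrtr.
have := ler_norm A; nra.
Unshelve. all: by end_near. Qed.

(** With k the integer part of the threshold, rate * t lies at k - x sqrt t up
    to a bounded error, and sqrt k is equivalent to sg * sqrt t. So, for t large,
    rate * t is between the points k + sqrt k * (a / sg) for a = - (x + e) and
    a = - (x - e), at which the distribution function is known to converge. *)
Lemma poisson_central_limit (x : R) :
  poisson_prob (rate * t) 0 [set j | j%:R <= rate * t + x * Num.sqrt t]
    @[t --> +oo] --> normal_prob 0 sg `]-oo, x].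
Proof.
apply: squeeze_normal_cdf => // e e0.
pose k t := Num.truncn (thr x t).
pose H a t := (poisson_cdf (k t) ((k t)%:R + Num.sqrt (k t)%:R * (a / sg)))%:E.
have cH a : H a t @[t --> +oo] --> normal_prob 0 sg `[a, +oo[.
  exact: (cvg_comp _ _ (@cvg_truncn x) (cvg_poisson_cdf sg_gt0 (a := a))).
exists (H (- (x - e))), (H (- (x + e))); split.
- by rewrite -normal_prob_tail_sym.
- by rewrite -normal_prob_tail_sym.
have cq a : Num.sqrt (k t)%:R / Num.sqrt t * (a / sg) @[t --> +oo] --> a.
  have : Num.sqrt (k t)%:R / Num.sqrt t * (a / sg) @[t --> +oo] --> sg * (a / sg).
    by apply: cvgM; [exact: cvg_sqrt_ratio|exact: cvg_cst].
  by rewrite [sg * _]mulrC divfK// gt_eqF.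
have e20 : 0 < e / 2 by rewrite divr_gt0.
near=> t.
have t0 : 0 < t by near: t; exact: nbhs_pinfty_gt.
have s0 : 0 < Num.sqrt t by rewrite sqrtr_gt0.
have thr0 : 0 <= thr x t by near: t; exact: near_thr_ge0.
have -> : [set j | j%:R <= rate * t + x * Num.sqrt t] =
    [set j | (j <= k t)%N].
  by apply/seteqP; split => j /=; rewrite /k truncn_ge_nat.
rewrite poisson_prob_le; last by rewrite mulr_ge0// ltW.
rewrite /H !lee_fin.
have b1 : (rate * t - (k t)%:R) / Num.sqrt t < - x + e / 2.
  near: t; apply: (cvgr_lt (- x)); first exact: cvg_deviation.
  by lra.
have b2 : - x - e / 2 < (rate * t - (k t)%:R) / Num.sqrt t.
  near: t; apply: (cvgr_gt (- x)); first exact: cvg_deviation.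
  by lra.
have b3 : - x + e / 2 < Num.sqrt (k t)%:R / Num.sqrt t * (- (x - e) / sg).
  by near: t; apply: (cvgr_gt (- (x - e))); [exact: cq|lra].
have b4 : Num.sqrt (k t)%:R / Num.sqrt t * (- (x + e) / sg) < - x - e / 2.
  by near: t; apply: (cvgr_lt (- (x + e))); [exact: cq|lra].
have k0 : 0 <= (k t)%:R + Num.sqrt (k t)%:R * (- (x + e) / sg).
  near: t.
  have : (Num.sqrt (k t)%:R : R) @[t --> +oo] --> +oo.
    apply: (cvg_comp _ _ _ (@cvgy_sqrt R)).
    exact: (cvg_comp _ _ (@cvg_truncn x) (@cvgr_idn R)).
  move=> /cvgryPge/(_ (- (- (x + e) / sg))); apply: filterS => t h.
  rewrite -{1}[(k t)%:R]sqr_sqrtr// expr2 -mulrDr mulr_ge0//.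
  by rewrite -lerBlDr sub0r.
rewrite mulrAC in b3; rewrite mulrAC in b4.
have b13 := lt_trans b1 b3; have b24 := lt_trans b4 b2.
rewrite ltr_pM2r ?invr_gt0// in b13; rewrite ltr_pM2r ?invr_gt0// in b24.
apply/andP; split; apply: poisson_cdf_le => //.
- by rewrite mulr_ge0// ltW.
- by rewrite addrC -lerBlDr ltW.
- by rewrite addrC -lerBrDr ltW.
Unshelve. all: by end_near. Qed.

End poisson_central_limit.

(** * Independence and moments *)

Lemma measurable_set_of_bool d (T : measurableType d) (f : T -> bool) :
  measurable_fun [set: T] f -> measurable [set w | f w].
Proof.
move=> mf; have := mf measurableT [set true] I.
by rewrite setTI; congr measurable; apply/seteqP; split.
Qed.

Section independent_pairs.
Context d (T : measurableType d) (R : realType) (P : probability T R).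
Context d1 d2 (T1 : measurableType d1) (T2 : measurableType d2).
Variables (X : {RV P >-> T1}) (Y : {RV P >-> T2}).
Hypothesis indepXY : independent2 P (sigma_of X) (sigma_of Y).
Local Open Scope ereal_scope.

Let XY (w : T) := (X w, Y w).

Let measurable_XY : measurable_fun [set: T] XY.
Proof. by apply: measurable_fun_pair. Qed.

Let XY_rv : {RV P >-> (T1 * T2)%type} := mfun_Sub (mem_set measurable_XY).

(** Independence is the product rule on rectangles, which determine a measure
    on the product space. *)
Lemma independent_joint_law (C : set (T1 * T2)) : measurable C ->
  P [set w | C (X w, Y w)] = (distribution P X \x distribution P Y) C.
Proof.
move=> mC.
rewrite (@product_measure_unique _ _ _ _ _ _ _ (distribution P XY_rv))//.
move=> A B mA mB.
have := indepXY (A := X @^-1` A) (B := Y @^-1` B).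
by apply; [exists A => //; rewrite setTI|exists B => //; rewrite setTI].
Qed.

Lemma ge0_integral_indep (f : T1 -> \bar R) (g : T2 -> \bar R) :
  measurable_fun [set: T1] f -> measurable_fun [set: T2] g ->
  (forall x, 0 <= f x) -> (forall y, 0 <= g y) ->
  \int[P]_w (f (X w) * g (Y w)) = \int[P]_w f (X w) * \int[P]_w g (Y w).
Proof.
move=> mf mg f0 g0.
have mfg : measurable_fun [set: T1 * T2] (fun z => f z.1 * g z.2).
  by apply: emeasurable_funM; apply: measurableT_comp.
have fg0 z : 0 <= f z.1 * g z.2 by rewrite mule_ge0.
transitivity (\int[distribution P XY_rv]_z (f z.1 * g z.2)).
  by rewrite ge0_integral_distribution.
rewrite (eq_measure_integral (distribution P X \x distribution P Y)); last first.
  by move=> A mA _; exact: independent_joint_law.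
rewrite fubini_tonelli1//; rewrite /fubini_F/=.
under eq_integral do rewrite ge0_integralZl//.
rewrite ge0_integralZr//; last exact: integral_ge0.
by rewrite !ge0_integral_distribution.
Qed.

End independent_pairs.

Section natural_measures.
Context (R : realType).
Local Open Scope ereal_scope.

Lemma ge0_integral_natE (m : {measure set nat -> \bar R}) (f : nat -> \bar R) :
  (forall k, 0 <= f k) -> \int[m]_k f k = \sum_(k <oo) f k * m [set k].
Proof.
move=> f0.
have -> : [set: nat] = \bigcup_k [set k] :> set nat.
  by apply/seteqP; split => // k _; exists k.
rewrite ge0_integral_bigcup//; last first.
  by move=> i j _ _ [x [/= -> ->]].
apply: eq_eseriesr => k _.
transitivity (\int[m]_(x in [set k]) f k).
  by apply: eq_integral => x; rewrite inE/= => ->.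
by rewrite integral_cst.
Qed.

(** The recursion (k + 1) p(k + 1) = mu p(k) of the Poisson weights turns the
    factorial moment of order m + 1 into mu times that of order m. *)
Lemma poisson_factorial_moment (mu : R) (m : nat) : (0 < mu)%R ->
  \sum_(k <oo) (k ^_ m)%:R%:E * poisson_prob mu 0%N [set k] = (mu ^+ m)%:E.
Proof.
move=> mu0.
have ge0 j k : 0 <= (k ^_ j)%:R%:E * poisson_prob mu 0%N [set k].
  by rewrite mule_ge0// lee_fin.
elim: m => [|m IH].
  transitivity (\int[poisson_prob mu 0%N]_k cst 1 k).
    by rewrite ge0_integral_natE//; apply: eq_eseriesr => k _.
  by rewrite integral_cst// mul1e expr0; exact: probability_setT.
rewrite nneseries_recl// ffact0n mul0e add0e -nneseries_addn//.
rewrite exprS EFinM -IH -nneseriesZl//; apply: eq_eseriesr => k _.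
rewrite addn1 ffactSS !poisson_prob1// -!EFinM; congr EFin.
have k1 : (k.+1%:R != 0 :> R)%R by rewrite pnatr_eq0.
have f0 : (k`!%:R != 0 :> R)%R by rewrite pnatr_eq0 -lt0n fact_gt0.
rewrite factS !natrM exprS.
move: (k.+1%:R)%R (k`!%:R)%R (mu ^+ k)%R ((k ^_ m)%:R)%R (expR _) k1 f0.
by move=> a f y x e a0 f0; field; rewrite a0 f0.
Qed.

End natural_measures.

(** Chebyshev's inequality for a sum of nonnegative uncorrelated variables with
    the same mean. Nonnegativity allows all moments to be computed with integrals
    of nonnegative functions, the cross term of the variance being moved to the
    other side. *)
Section chebyshev_sum.
Context d (T : measurableType d) (R : realType) (P : probability T R).
Variables (n : nat) (W : 'I_n -> T -> R) (r v : R).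
Hypothesis mW : forall i, measurable_fun [set: T] (W i).
Hypothesis W_ge0 : forall i w, 0 <= W i w.
Hypothesis r_ge0 : 0 <= r.
Hypothesis mean_W : forall i, (\int[P]_w (W i w)%:E = r%:E)%E.
Hypothesis sqr_W : forall i, (\int[P]_w (W i w ^+ 2)%:E <= v%:E)%E.
Hypothesis uncorrelated_W : forall i j, i != j ->
  (\int[P]_w (W i w * W j w)%:E = (r * r)%:E)%E.

Let S w : R := \sum_(i < n) W i w.

Let measurable_S : measurable_fun [set: T] S.
Proof. by apply: measurable_sum. Qed.

Let S_ge0 w : 0 <= S w. Proof. by apply: sumr_ge0. Qed.

Let mean_S : (\int[P]_w (S w)%:E = (n%:R * r)%:E)%E.
Proof.
under eq_integral do rewrite /S -sumEFin.
rewrite ge0_integral_sum//=; last 2 first.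
- by move=> i; apply/measurable_EFinP.
- by move=> i w _; rewrite lee_fin.
rewrite (eq_bigr (fun=> r%:E)); last by move=> i _; exact: mean_W.
by rewrite sumEFin sumr_const card_ord mulr_natl.
Qed.

Let second_moment_S : (\int[P]_w (S w ^+ 2)%:E <= (n%:R * v + (n%:R * r) ^+ 2)%:E)%E.
Proof.
have SE w : S w ^+ 2 = \sum_(i < n) \sum_(j < n) W i w * W j w.
  by rewrite expr2 /S big_distrlr.
under eq_integral do rewrite SE -sumEFin.
rewrite ge0_integral_sum//=; last 2 first.
- move=> i; apply/measurable_EFinP; apply: measurable_sum => j.
  exact: measurable_funM.
- by move=> i w _; rewrite lee_fin sumr_ge0// => j _; rewrite mulr_ge0.
apply: (@le_trans _ _ (\sum_(i < n) \sum_(j < n)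
    (if i == j then v else r * r)%:E)%E).
  apply: lee_sum => i _.
  under eq_integral do rewrite -sumEFin.
  rewrite ge0_integral_sum//=; last 2 first.
  - move=> j; apply/measurable_EFinP; exact: measurable_funM.
  - by move=> j w _; rewrite lee_fin mulr_ge0.
  apply: lee_sum => j _; case: ifPn => [/eqP <-|ij].
    by under eq_integral do rewrite -expr2; exact: sqr_W.
  by rewrite uncorrelated_W.
have rr i : \sum_(j < n) (if i == j then v else r * r) <= v + n%:R * (r * r).
  rewrite (bigD1 i)//= eqxx lerD2l mulr_natl.
  apply: (@le_trans _ _ (\sum_(j < n | j != i) r * r)).
    by apply: ler_sum => j ji; rewrite eq_sym (negbTE ji).
  rewrite -[X in _ *+ X]card_ord -sumr_const [leRHS](bigID (fun j => j != i))/=.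
  by rewrite lerDl sumr_ge0// => j _; rewrite mulr_ge0.
under eq_bigr do rewrite sumEFin.
rewrite sumEFin lee_fin.
apply: (@le_trans _ _ (\sum_(i < n) (v + n%:R * (r * r)))).
  by apply: ler_sum => i _.
rewrite sumr_const card_ord -mulr_natl le_eqVlt; apply/orP; left.
by apply/eqP; ring.
Qed.

Let measurable_dev : measurable_fun [set: T] (fun w => (S w - n%:R * r) ^+ 2).
Proof. by apply: measurable_funX; exact: measurable_funB. Qed.

Let variance_S : (\int[P]_w ((S w - n%:R * r) ^+ 2)%:E <= (n%:R * v)%:E)%E.
Proof.
set m := n%:R * r.
have m0 : 0 <= m by rewrite mulr_ge0.
have h : (\int[P]_w ((S w - m) ^+ 2)%:E + (2 * m * m)%:E =
    \int[P]_w (S w ^+ 2)%:E + (m ^+ 2)%:E)%E.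
  have -> : (2 * m * m)%:E = (\int[P]_w ((2 * m)%:E * (S w)%:E))%E.
    rewrite ge0_integralZl//=.
    - by rewrite mean_S.
    - exact/measurable_EFinP.
    - by move=> w _; rewrite lee_fin.
    - by rewrite lee_fin mulr_ge0.
  have -> : (m ^+ 2)%:E = (\int[P]_w (cst (m ^+ 2)%:E w))%E.
    by rewrite integral_cst//= probability_setT mule1.
  rewrite -!ge0_integralD//=.
  - apply: eq_integral => w _; rewrite -EFinM -!EFinD; congr EFin; ring.
  - by move=> w _; rewrite lee_fin sqr_ge0.
  - by apply/measurable_EFinP; exact: measurable_funX.
  - by move=> w _; rewrite lee_fin sqr_ge0.
  - by move=> w _; rewrite lee_fin sqr_ge0.
  - exact/measurable_EFinP.
  - by move=> w _; rewrite -EFinM lee_fin !mulr_ge0.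
  - by apply/measurable_EFinP; exact: measurable_funM.
have := second_moment_S; rewrite -/m => sm.
rewrite -(@leeD2rE _ (2 * m * m)%:E)// h.
apply: (le_trans (leeD2r _ sm)); rewrite -EFinD lee_fin; lra.
Qed.

Lemma chebyshev_sum (e : R) : 0 < e ->
  (P [set w | (e <= `|\sum_(i < n) W i w - n%:R * r|)%R] <= (n%:R * v / e ^+ 2)%:E)%E.
Proof.
move=> e0; rewrite -/(S _); set A := (X in P X).
have mA : measurable A.
  apply: measurable_set_of_bool; apply: measurable_fun_ler => //.
  apply: measurableT_comp => //; exact: measurable_funB.
rewrite EFinM lee_pdivlMr ?exprn_gt0//.
have mdev : measurable_fun A (fun w => ((S w - n%:R * r) ^+ 2)%:E).
  by apply/measurable_EFinP; exact: measurable_funTS.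
apply: le_trans variance_S.
apply: (@le_trans _ _ (\int[P]_(w in A) ((S w - n%:R * r) ^+ 2)%:E)%E).
  rewrite muleC -integral_cst//; apply: ge0_le_integral => //.
  - by move=> w _; rewrite /= lee_fin sqr_ge0.
  - move=> w Aw; rewrite /= lee_fin -[leRHS]real_normK ?num_real//.
    by rewrite lerXn2r ?nnegrE ?(ltW e0).
apply: ge0_subset_integral => //.
- exact/measurable_EFinP.
- by move=> w _; rewrite lee_fin sqr_ge0.
Qed.

End chebyshev_sum.

(** * Poisson increments and cells containing an event *)

Lemma measurable_nat_preimage d (T : measurableType d) (X : {mfun T >-> nat})
  (A : set nat) : measurable (X @^-1` A).
Proof. by rewrite -[_ @^-1` _]setTI; exact: measurable_funP. Qed.

Section poisson_random_variable.
Context d (T : measurableType d) (R : realType) (P : probability T R).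
Variables (X : {RV P >-> nat}) (mu : R).
Hypothesis mu_gt0 : 0 < mu.
Hypothesis X_poisson : forall A : set nat, P (X @^-1` A) = poisson_prob mu 0 A.

Lemma measurable_nat_comp (Y : {RV P >-> nat}) (f : nat -> R) :
  measurable_fun [set: T] (fun w => f (Y w)).
Proof. exact: (measurableT_comp (f := f)). Qed.

Let integral_poissonE (f : nat -> R) : (forall k, 0 <= f k) ->
  (\int[P]_w (f (X w))%:E = \sum_(k <oo) (f k)%:E * poisson_prob mu 0%N [set k])%E.
Proof.
move=> f0; rewrite -(@ge0_integral_distribution _ _ _ _ _ P X (EFin \o f))//.
rewrite ge0_integral_natE//.
by apply: eq_eseriesr => k _; rewrite -X_poisson.
Qed.

Let mean_poisson : (\int[P]_w (X w)%:R%:E = mu%:E)%E.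
Proof.
rewrite (@integral_poissonE (fun k => k%:R))//.
have := poisson_factorial_moment 1 mu_gt0; rewrite expr1 => <-.
by apply: eq_eseriesr => k _; rewrite ffactn1.
Qed.

Let factorial_moment2 : (\int[P]_w (X w * (X w).-1)%:R%:E = (mu ^+ 2)%:E)%E.
Proof.
rewrite (@integral_poissonE (fun k => (k * k.-1)%:R))//.
rewrite -(poisson_factorial_moment 2 mu_gt0).
apply: eq_eseriesr => k _; by congr (_%:E * _)%E; rewrite ffactnSr ffactn1 subn1.
Qed.

Lemma prob_poisson_gt0 : P [set w | (0 < X w)%N] = (1 - expR (- mu))%:E.
Proof.
have -> : [set w | (0 < X w)%N] = ~` (X @^-1` [set 0%N]).
  by apply/seteqP; split => w /=; rewrite lt0n => /eqP.
rewrite probability_setC; last exact: measurable_nat_preimage.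
by rewrite X_poisson poisson_prob1// expr0 fact0 divr1 mulr1 -EFinB.
Qed.

(** X.-1 counts the events beyond the first one: X.-1 + 1_(X > 0) = X. *)
Lemma excess_mean : (\int[P]_w (X w).-1%:R%:E = (mu - (1 - expR (- mu)))%:E)%E.
Proof.
have mA : measurable [set w | (0 < X w)%N].
  exact: (measurable_nat_preimage X [set k | (0 < k)%N]).
have : (\int[P]_w (X w).-1%:R%:E + (1 - expR (- mu))%:E = mu%:E)%E.
  rewrite -prob_poisson_gt0 -[[set w | _]]setIT -integral_indic// -mean_poisson.
  rewrite -ge0_integralD//=.
  - apply: eq_integral => w _; rewrite -EFinD indicE; congr EFin.
    rewrite -natrD; congr (_%:R).
    have [X0|X0] := posnP (X w); first by rewrite memNset ?X0//= X0.
    by rewrite mem_set//= addn1 prednK.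
  - by apply/measurable_EFinP; exact: (measurable_nat_comp X (fun k => k.-1%:R)).
  - by apply/measurable_EFinP; exact: measurable_indic.
by move=> h; rewrite EFinB -h -addeA -EFinB subrr adde0.
Qed.

(** (X.-1)^2 <= X (X - 1) on the naturals; the bound is of second order in mu, like
    the probability of two events, whereas the second moment of X is of first order. *)
Lemma excess_sqr : (\int[P]_w ((X w).-1%:R ^+ 2)%:E <= (mu ^+ 2)%:E)%E.
Proof.
rewrite -factorial_moment2; apply: ge0_le_integral => //=.
- apply/measurable_EFinP; exact: (measurable_nat_comp X (fun k => k.-1%:R ^+ 2)).
- apply/measurable_EFinP; exact: (measurable_nat_comp X (fun k => (k * k.-1)%:R)).
- by move=> w _; rewrite lee_fin -natrX ler_nat expnS expn1 leq_mul2r leq_pred orbT.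
Qed.

End poisson_random_variable.

Section poisson_increments.
Context d (T : measurableType d) (R : realType) (P : probability T R).
Variables (lambda : R) (N : R -> {RV P >-> nat}).
Hypothesis N_poisson : poisson_process lambda N.

Lemma measurable_increment a b : measurable_fun [set: T] (increment N a b).
Proof. by apply: measurable_fun_subn. Qed.

Definition increment_rv a b : {RV P >-> nat} :=
  mfun_Sub (mem_set (measurable_increment a b)).

Lemma increment_law a b (A : set nat) : 0 <= a -> a <= b ->
  P (increment_rv a b @^-1` A) = poisson_prob (lambda * (b - a)) 0 A.
Proof. by move=> a0 ab; have [_ _] := N_poisson; apply. Qed.

Lemma count_law t (A : set nat) : 0 <= t ->
  P (N t @^-1` A) = poisson_prob (lambda * t) 0 A.
Proof.
move=> t0; rewrite -[in RHS](subr0 t) -(increment_law)//.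
congr (P _); apply/seteqP; split => w /=; rewrite /increment;
  by have [-> _ _] := N_poisson; rewrite subn0.
Qed.

Lemma increments_independent (t : nat -> R) (i j : nat) :
  0 <= t 0%N -> (forall i, t i <= t i.+1) -> i != j ->
  independent2 P (sigma_of (increment_rv (t i) (t i.+1)))
                 (sigma_of (increment_rv (t j) (t j.+1))).
Proof.
move=> t0 tS ij A B FA FB; have [_ indep _] := N_poisson.
have := indep t t0 tS [:: i; j] (fun k => if k == i then A else B).
rewrite !big_cons !big_nil eqxx eq_sym (negbTE ij) setIT mule1; apply.
  by rewrite /= inE ij.
move=> k; rewrite !inE => /orP[] /eqP ->; first by rewrite eqxx.
by rewrite eq_sym (negbTE ij).
Qed.

End poisson_increments.

Section cell_count.
Context d (T : measurableType d) (R : realType) (P : probability T R).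
Variables (lambda : R) (N : R -> {RV P >-> nat}).
Hypothesis lambda_gt0 : 0 < lambda.
Hypothesis N_poisson : poisson_process lambda N.
Hypothesis N_mono : forall a b w, 0 <= a -> a <= b -> (N a w <= N b w)%N.

Let cell (D : R) (i : nat) : {RV P >-> nat} :=
  increment_rv N (i%:R * D) (i.+1%:R * D).

Definition hit_count (D : R) (n : nat) (w : T) : nat :=
  \sum_(i < n) (0 < increment N (i%:R * D) (i.+1%:R * D) w).

Lemma measurable_hit_count D n (A : set nat) :
  measurable [set w | A (hit_count D n w)].
Proof.
have m : measurable_fun [set: T] (fun w => hit_count D n w).
  rewrite /hit_count; elim: n => [|n IH].
    by under eq_fun do rewrite big_ord0; exact: measurable_cst.
  under eq_fun do rewrite big_ord_recr/=.
  apply: measurable_fun_addn => //.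
  exact: (measurableT_comp (f := fun k : nat => nat_of_bool (0 < k)%N)
    _ (measurable_increment N _ _)).
by rewrite -[[set w | _]]setTI; exact: m.
Qed.

Lemma count_hitE D n w : 0 <= D ->
  (N (n%:R * D) w = hit_count D n w + \sum_(i < n) (cell D i w).-1)%N.
Proof.
move=> D0; rewrite /hit_count -big_split/=.
have -> : (\sum_(i < n) ((0 < increment N (i%:R * D) (i.+1%:R * D) w) + (cell D i w).-1)
    = \sum_(i < n) (N (i.+1%:R * D) w - N (i%:R * D) w))%N.
  by apply: eq_bigr => i _; rewrite /cell/= /increment; case: (_ - _)%N.
elim: n => [|n IH].
  by rewrite big_ord0 mul0r; have [-> _ _] := N_poisson.
by rewrite big_ord_recr/= -IH subnKC// N_mono ?mulr_ge0// ler_wpM2r ?ler_nat.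
Qed.

Let hit_prob D : R := 1 - expR (- (lambda * D)).

Definition overcount D n w : R := \sum_(i < n) (cell D i w).-1%:R.

(** The counts N(n D) and [hit_count] differ by a sum of n independent terms of
    variance at most (lambda D)^2. With e of order sqrt (n D), the bound is of order
    D: the centred difference is negligible as D tends to 0, although the
    difference itself need not be. *)
Lemma overcount_deviation D n (e : R) : 0 < D -> 0 < e ->
  (P [set w | (e <= `|overcount D n w - n%:R * (lambda * D - hit_prob D)|)%R]
   <= (n%:R * (lambda * D) ^+ 2 / e ^+ 2)%:E)%E.
Proof.
move=> D0 e0; set mu := lambda * D.
have mu0 : 0 < mu by rewrite mulr_gt0.
have t0 : (0 : R) <= 0%:R * D by rewrite mul0r.
have tS i : i%:R * D <= i.+1%:R * D by rewrite ler_wpM2r ?ler_nat// ltW.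
have lawc i A : P (cell D i @^-1` A) = poisson_prob mu 0 A.
  rewrite (increment_law N_poisson)//; last by rewrite mulr_ge0// ltW.
  by rewrite -mulrBl -natrB// subSnn mul1r.
have Em i := excess_mean mu0 (lawc i).
have m_ge0 : 0 <= mu - hit_prob D.
  have := expR_ge1Dx (- mu); rewrite /hit_prob -/mu; lra.
apply: (@chebyshev_sum _ _ _ P n (fun i w => (cell D i w).-1%:R)) => //.
- by move=> i; exact: (measurable_nat_comp (cell D i) (fun k => k.-1%:R)).
- by move=> i; exact: excess_sqr.
- move=> i j ij.
  have := @increments_independent _ _ _ P lambda N N_poisson
     (fun k => k%:R * D) i j t0 tS ij.
  move=> /ge0_integral_indep /(_ (fun k => k.-1%:R%:E) (fun k => k.-1%:R%:E)).
  move=> h; under eq_integral do rewrite EFinM.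
  by rewrite h// !Em -EFinM.
Qed.

End cell_count.

Lemma count_central_limit d (T : measurableType d) (R : realType)
  (P : probability T R) (lambda : R) (N : R -> {RV P >-> nat}) (x : R) :
  0 < lambda -> poisson_process lambda N ->
  P [set w | (N t w)%:R <= lambda * t + x * Num.sqrt t] @[t --> +oo] -->
  normal_prob 0 (Num.sqrt lambda) `]-oo, x].
Proof.
move=> l0 Np; have := poisson_central_limit l0 (x := x).
apply: cvg_trans; apply: near_eq_cvg; near=> t.
by rewrite -(count_law Np)//; near: t; exact: nbhs_pinfty_ge.
Unshelve. all: by end_near. Qed.

Section hit_count_limit.
Context d (T : measurableType d) (R : realType) (P : probability T R).
Variables (lambda : R) (N : R -> {RV P >-> nat}) (Delta : nat -> R).
Hypothesis lambda_gt0 : 0 < lambda.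
Hypothesis N_poisson : poisson_process lambda N.
Hypothesis N_mono : forall a b w, 0 <= a -> a <= b -> (N a w <= N b w)%N.
Hypothesis Delta_gt0 : forall n, (0 < n)%N -> 0 < Delta n.
Hypothesis horizon : n%:R * Delta n @[n --> \oo] --> +oo.
Hypothesis Delta_cvg0 : Delta n @[n --> \oo] --> 0.

Let rate n : R := Num.sqrt (n%:R * Delta n).

Let cvg_rate : rate n @[n --> \oo] --> +oo.
Proof. exact: (cvg_comp _ _ horizon (@cvgy_sqrt R)). Qed.

(** The number of cells at which the estimator reaches lambda + x / rate. *)
Definition hit_threshold (x : R) n : R :=
  n%:R * (1 - expR (- (Delta n * (lambda + x / rate n)))).

(** Since 1 - exp (- (lambda D)) is the probability that a cell contains an event,
    this is the position of the threshold relative to the mean count. *)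
Let cvg_threshold x :
  (hit_threshold x n - n%:R * (1 - expR (- (lambda * Delta n)))) / rate n
    @[n --> \oo] --> x.
Proof.
have cL : expR (- (lambda * Delta n)) @[n --> \oo] --> (1 : R).
  rewrite -expR0; apply: continuous_cvg; first exact: continuous_expR.
  rewrite -oppr0 -(mulr0 lambda).
  by apply: cvgN; apply: cvgM => //; exact: cvg_cst.
have cZ : expR (- (Delta n * (x / rate n))) @[n --> \oo] --> (1 : R).
  rewrite -expR0; apply: continuous_cvg; first exact: continuous_expR.
  rewrite -oppr0 -(mulr0 0); apply: cvgN; apply: cvgM => //.
  rewrite -(mulr0 x); apply: cvgM; first exact: cvg_cst.
  apply/gtr0_cvgV0; last exact: cvg_rate.
  by move/cvgryPgt : cvg_rate; exact.
have cU : x * expR (- (lambda * Delta n)) @[n --> \oo] --> x.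
  by rewrite -[X in _ --> X]mulr1; apply: cvgM => //; exact: cvg_cst.
have cD : x * expR (- (lambda * Delta n)) * expR (- (Delta n * (x / rate n)))
    @[n --> \oo] --> x.
  by rewrite -[X in _ --> X]mulr1; apply: cvgM.
apply: squeeze_cvgr cD cU; near=> n.
have n0 : (0 < n)%N by near: n; exact: nbhs_infty_gt.
have nR : 0 < n%:R :> R by rewrite ltr0n.
have D0 := Delta_gt0 n0.
have T0 : 0 < n%:R * Delta n by rewrite mulr_gt0.
have r0 : 0 < rate n by rewrite sqrtr_gt0.
have rr : rate n ^+ 2 = n%:R * Delta n by rewrite sqr_sqrtr// ltW.
rewrite /hit_threshold [Delta n * (_ + _)]mulrDr opprD expRD [Delta n * lambda]mulrC.
set a := expR (- (lambda * Delta n)).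
have a0 : 0 < a by exact: expR_gt0.
set z := Delta n * (x / rate n).
have xE : x = n%:R * z / rate n.
  by rewrite /z mulrA -rr; field; rewrite gt_eqF.
have -> : n%:R * (1 - a * expR (- z)) - n%:R * (1 - a) =
    n%:R * (a * (1 - expR (- z))) by ring.
have z1 : 1 - expR (- z) <= z by have := expR_ge1Dx (- z); lra.
have z2 : z * expR (- z) <= 1 - expR (- z).
  have := expR_ge1Dx z; have := expR_gt0 (- z) => ez ez'.
  have : (1 + z) * expR (- z) <= expR z * expR (- z) by rewrite ler_pM2r.
  by rewrite -expRD subrr expR0; lra.
have -> : x * a = n%:R * (a * z) / rate n by rewrite {1}xE; ring.
apply/andP; split.
- have -> : n%:R * (a * z) / rate n * expR (- z) =
      n%:R * (a * (z * expR (- z))) / rate n by ring.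
  by rewrite ler_pM2r ?invr_gt0// ler_pM2l// ler_pM2l.
- by rewrite ler_pM2r ?invr_gt0// ler_pM2l// ler_pM2l.
Unshelve. all: by end_near. Qed.

Let cvg_error (e : R) : 0 < e ->
  ((n%:R * (lambda * Delta n) ^+ 2 / (e * rate n) ^+ 2)%:E : \bar R)
    @[n --> \oo] --> 0%:E.
Proof.
move=> e0; apply: cvg_EFin; first exact: nearW.
have : lambda ^+ 2 / e ^+ 2 * Delta n @[n --> \oo] --> (0 : R).
  by rewrite -(mulr0 (lambda ^+ 2 / e ^+ 2)); apply: cvgM => //; exact: cvg_cst.
apply: cvg_trans; apply: near_eq_cvg; near=> n.
have n0 : (0 < n)%N by near: n; exact: nbhs_infty_gt.
have nR : 0 < n%:R :> R by rewrite ltr0n.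
have D0 := Delta_gt0 n0.
rewrite /= [(e * _) ^+ 2]exprMn sqr_sqrtr ?mulr_ge0 ?ltW//; field.
by rewrite !gt_eqF.
Unshelve. all: by end_near. Qed.

(** Off the event B that the centred overcount exceeds e / 2 times the rate,
    comparing [hit_count] with its threshold amounts to comparing N(T) with
    lambda T + x rate, up to e rate. *)
Lemma hit_count_central_limit x :
  P [set w | (hit_count N (Delta n) n w)%:R <= hit_threshold x n]
    @[n --> \oo] --> normal_prob 0 (Num.sqrt lambda) `]-oo, x].
Proof.
have sg0 : 0 < Num.sqrt lambda by rewrite sqrtr_gt0.
apply: squeeze_normal_cdf => // e e0.
have e20 : 0 < e / 2 by rewrite divr_gt0.
pose C y n := P [set w | (N (n%:R * Delta n) w)%:R
    <= lambda * (n%:R * Delta n) + y * rate n].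
have cC y : C y n @[n --> \oo] --> normal_prob 0 (Num.sqrt lambda) `]-oo, y].
  exact: (cvg_comp _ _ horizon (count_central_limit lambda_gt0 N_poisson (x := y))).
pose E n : \bar R := (n%:R * (lambda * Delta n) ^+ 2 / (e / 2 * rate n) ^+ 2)%:E.
have cE : E n @[n --> \oo] --> 0%:E by exact: cvg_error.
exists (fun n => C (x - e)%R n - E n)%E, (fun n => C (x + e)%R n + E n)%E; split.
- rewrite -[X in _ --> X]sube0; apply: cvgeB => //.
  by rewrite fin_num_adde_defl.
- rewrite -[X in _ --> X]adde0; apply: cvgeD => //.
  by rewrite fin_num_adde_defl.
pose b n := n%:R * (1 - expR (- (lambda * Delta n))).
near=> n.
have n0 : (0 < n)%N by near: n; exact: nbhs_infty_gt.
have D0 := Delta_gt0 n0.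
have T0 : 0 <= n%:R * Delta n by rewrite mulr_ge0// ltW.
have r0 : 0 < rate n by rewrite sqrtr_gt0 mulr_gt0// ltr0n.
have b1 : (hit_threshold x n - b n) / rate n < x + e / 2.
  by near: n; apply: (cvgr_lt x); [exact: cvg_threshold|lra].
have b2 : x - e / 2 < (hit_threshold x n - b n) / rate n.
  by near: n; apply: (cvgr_gt x); [exact: cvg_threshold|lra].
rewrite ltr_pdivrMr// in b1; rewrite ltr_pdivlMr// in b2.
have dev := @overcount_deviation _ _ _ P _ _ lambda_gt0 N_poisson (Delta n) n
  (e / 2 * rate n) D0 (mulr_gt0 e20 r0).
rewrite -/(E n) in dev; set B := (X in P X) in dev.
have mN (y : R) : measurable [set w | (N (n%:R * Delta n) w)%:R <= y].
  exact: (measurable_nat_preimage (N (n%:R * Delta n)) [set k | k%:R <= y]).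
have mK (y : R) : measurable [set w | (hit_count N (Delta n) n w)%:R <= y].
  exact: (measurable_hit_count N (Delta n) n [set k | k%:R <= y]).
have split w : (N (n%:R * Delta n) w)%:R = (hit_count N (Delta n) n w)%:R
    + overcount N (Delta n) n w :> R.
  by rewrite (count_hitE N_poisson N_mono n w (ltW D0)) natrD; congr (_ + _); rewrite natr_sum.
have mB : measurable B.
  apply: measurable_set_of_bool; apply: measurable_fun_ler => //.
  apply: measurableT_comp => //; apply: measurable_funB => //.
  by apply: measurable_sum => i; exact: (measurable_nat_comp _ (fun k => k.-1%:R)).
have nB w : ~ B w ->
    `|overcount N (Delta n) n w
      - n%:R * (lambda * Delta n - (1 - expR (- (lambda * Delta n))))|
    < e / 2 * rate n by move=> /negP; rewrite -ltNge.
have le_add A1 A2 : measurable A1 -> measurable A2 -> A1 `<=` A2 `|` B ->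
    (P A1 <= P A2 + E n)%E.
  move=> m1 m2 sub; apply: (@le_trans _ _ (P A2 + P B)%E); last exact: leeD2l.
  apply: (@le_trans _ _ (P (A2 `|` B))); last exact: measureU2.
  by apply: le_measure => //; rewrite inE//; exact: measurableU.
apply/andP; split.
- rewrite leeBlDr//; apply: le_add => // w /= h.
  have [Bw|nBw] := pselect (B w); first by right.
  left; have := nB w nBw; rewrite ltr_distlC => /andP[h1 h2]; move: h; rewrite split => h.
  rewrite /b in b1 b2 *; nra.
- apply: le_add => // w /= h.
  have [Bw|nBw] := pselect (B w); first by right.
  left; have := nB w nBw; rewrite ltr_distlC => /andP[h1 h2]; rewrite split.
  rewrite /b in b1 b2 *; nra.
Unshelve. all: by end_near. Qed.

End hit_count_limit.

(** * Displacement of the flight *)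

Section polygonal_path.
Context {R : realType}.
Implicit Types (L x y : nat -> R).

(** The deficit in the triangle inequality for the vectors L_i (x_i, y_i) is the
    sum of the deficits of the pairs, so one pair of different directions with
    positive lengths makes it strict. *)
Lemma polygonal_path_lt L x y (m k : nat) :
  (m < k)%N ->
  (forall j, (m <= j <= k)%N -> 0 <= L j) ->
  0 < L m -> 0 < L m.+1 ->
  (forall j, x j ^+ 2 + y j ^+ 2 = 1) ->
  x m * x m.+1 + y m * y m.+1 != 1 ->
  (\sum_(m <= j < k.+1) L j * x j) ^+ 2 + (\sum_(m <= j < k.+1) L j * y j) ^+ 2
  < (\sum_(m <= j < k.+1) L j) ^+ 2.
Proof.
move=> mk L0 Lm Lm1 unit xy1.
have inner_le1 i j : x i * x j + y i * y j <= 1.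
  by have := unit i; have := unit j; have := sqr_ge0 (x i - x j);
    have := sqr_ge0 (y i - y j); nra.
pose pair_deficit i j := L i * L j * (1 - (x i * x j + y i * y j)).
have pd_ge0 i j : (m <= i <= k)%N -> (m <= j <= k)%N -> 0 <= pair_deficit i j.
  by move=> mi mj; rewrite !mulr_ge0 ?L0// subr_ge0.
have rng i : (m <= i)%N -> (i < k.+1)%N -> (m <= i <= k)%N.
  by rewrite ltnS => -> ->.
rewrite -subr_gt0.
have -> : (\sum_(m <= j < k.+1) L j) ^+ 2 -
    ((\sum_(m <= j < k.+1) L j * x j) ^+ 2 + (\sum_(m <= j < k.+1) L j * y j) ^+ 2)
    = \sum_(m <= i < k.+1) \sum_(m <= j < k.+1) pair_deficit i j.
  rewrite !expr2 !big_distrlr/= -!big_split/= -sumrB; apply: eq_bigr => i _.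
  rewrite -!big_split/= -sumrB; apply: eq_bigr => j _.
  by rewrite /pair_deficit; ring.
rewrite big_ltn ?(ltnW mk)//; last exact: ltnW.
rewrite ltr_pwDl//; last first.
  rewrite big_nat_cond sumr_ge0// => i /andP[/andP[mi ik] _].
  rewrite big_nat_cond sumr_ge0// => j /andP[/andP[mj jk] _].
  by apply: pd_ge0; apply: rng => //; exact: ltnW.
rewrite big_ltn; last exact: ltnW.
rewrite big_ltn//= addrCA ltr_pwDl//.
  by rewrite /pair_deficit !mulr_gt0// subr_gt0 lt_neqAle xy1 inner_le1.
have rm : (m <= m <= k)%N by rewrite leqnn ltnW.
rewrite addr_ge0 ?pd_ge0//.
rewrite big_nat_cond sumr_ge0// => j /andP[/andP[mj jk] _].
apply: pd_ge0 => //; apply: rng => //.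
by rewrite (leq_trans _ mj)// -addn2 leq_addr.
Qed.

End polygonal_path.

Section displacement.
Context {R : realType}.
Variables (a b : R) (s : nat -> R) (m k : nat).
Hypothesis mk : (m <= k)%N.

Let clipped t n j : R := (if j == n then t else s j.+1) - s j.

(** Time spent in direction j between the times a and b, for counts m and k of
    the events up to a and b. *)
Definition sojourn j : R :=
  (if j == k then b else s j.+1) - (if j == m then a else s j).

Lemma sum_sojourn (f : nat -> R) :
  \sum_(0 <= j < k.+1) clipped b k j * f j - \sum_(0 <= j < m.+1) clipped a m j * f j
  = \sum_(m <= j < k.+1) sojourn j * f j.
Proof.
rewrite (@big_cat_nat _ _ _ m 0 k.+1)//=; last by rewrite (leq_trans mk).
rewrite [X in _ - X]big_nat_recr//=.
have -> : \sum_(0 <= i < m) clipped b k i * f i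
    = \sum_(0 <= i < m) clipped a m i * f i.
  rewrite big_nat_cond [RHS]big_nat_cond; apply: eq_bigr => i /andP[/andP[_ im] _].
  by rewrite /clipped !ltn_eqF// (leq_trans im).
rewrite addrAC opprD addrA subrr sub0r.
rewrite big_ltn// [RHS]big_ltn// /clipped /sojourn !eqxx.
have -> : \sum_(m.+1 <= j < k.+1) ((if j == k then b else s j.+1) - s j) * f j
   = \sum_(m.+1 <= j < k.+1)
     ((if j == k then b else s j.+1) - (if j == m then a else s j)) * f j.
  rewrite big_nat_cond [RHS]big_nat_cond; apply: eq_bigr => i /andP[/andP[mi _] _].
  by rewrite (gtn_eqF mi).
by ring.
Qed.

Lemma sojourn_total : s 0%N = 0 -> \sum_(m <= j < k.+1) sojourn j = b - a.
Proof.
move=> s0.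
have tele t n : \sum_(0 <= j < n.+1) clipped t n j * 1 = t.
  rewrite big_nat_recr//= /clipped eqxx mulr1.
  have -> : \sum_(0 <= i < n) ((if i == n then t else s i.+1) - s i) * 1
     = \sum_(0 <= i < n) (s i.+1 - s i).
    rewrite big_nat_cond [RHS]big_nat_cond; apply: eq_bigr => i /andP[/andP[_ im] _].
    by rewrite mulr1 ltn_eqF.
  by rewrite telescope_sumr// s0 subr0 addrC subrK.
have := sum_sojourn (fun=> 1); rewrite !tele => ->.
by apply: eq_bigr => j _; rewrite mulr1.
Qed.

End displacement.

Section event_times.
Context d (T : measurableType d) (R : realType) (P : probability T R).
Variables (N : R -> {RV P >-> nat}) (s : nat -> T -> R).
Hypothesis s_times : event_times N s.

Lemma count_mono a b w : 0 <= a -> a <= b -> (N a w <= N b w)%N.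
Proof.
move=> a0 ab; have [_ _ sN] := s_times w.
rewrite -sN ?(le_trans a0)//; apply: le_trans ab.
by rewrite sN.
Qed.

Lemma event_time_ge0 k w : 0 <= s k w.
Proof.
have [s0 sS _] := s_times w.
by elim: k => [|k IH]; [rewrite s0|exact: (le_trans IH (ltW (sS k)))].
Qed.

(** s k > a exactly when fewer than k events have occurred up to a. *)
Lemma measurable_event_time k : measurable_fun [set: T] (s k).
Proof.
move=> mD; apply: (measurability _ (RGenOInfty.measurableE R)) => //.
move=> /= _ [_ [a ->] <-]; rewrite setTI preimage_itvoy.
have [a0|a0] := leP 0 a.
  rewrite (_ : [set w | _] = N a @^-1` [set i | (i < k)%N]).
    exact: measurable_nat_preimage.
  apply/seteqP; split => w /=; have [_ _ sN] := s_times w;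
    by rewrite ltNge sN// -ltnNge.
rewrite (_ : [set w | _] = setT)//; apply/seteqP; split => // w _ /=.
exact: lt_le_trans (event_time_ge0 k w).
Qed.

Lemma measurable_fun_index (K : T -> nat) (f : nat -> T -> R) :
  measurable_fun [set: T] K -> (forall k, measurable_fun [set: T] (f k)) ->
  measurable_fun [set: T] (fun w => f (K w) w).
Proof.
move=> mK mf _ Y mY; rewrite setTI.
rewrite (_ : _ @^-1` _ = \bigcup_k (K @^-1` [set k] `&` f k @^-1` Y)).
  apply: bigcupT_measurable => k; apply: measurableI.
    by rewrite -[_ @^-1` _]setTI; exact: mK.
  by rewrite -[_ @^-1` _]setTI; exact: mf.
apply/seteqP; split => w /=; first by exists (K w).
by move=> [k _ [/= <-]].
Qed.

End event_times.

Section trigonometry.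
Context {R : realType}.
Implicit Types x y : R.

Lemma cos_eq1_small x : - (2 * pi) < x -> x < 2 * pi -> cos x = 1 -> x = 0.
Proof.
have pos (z : R) : 0 < z -> z < 2 * pi -> cos z != 1.
  move=> z0 zpi; have := @sin_gt0_pi R (z / 2).
  rewrite divr_gt0//= ltr_pdivrMr// [pi * 2]mulrC => /(_ zpi) s0.
  have -> : z = (z / 2) *+ 2 by rewrite -mulr_natr divfK.
  rewrite cos_mulr2n cos2sin2; apply/eqP => e.
  by have := exprn_gt0 2 s0; rewrite -mulr_natr in e; lra.
move=> lx ux cx; apply/eqP; case: (ltgtP x 0) => // x0.
- by have := pos (- x); rewrite oppr_gt0 x0 ltrNl cosN cx eqxx => /(_ isT lx).
- by have := pos x x0 ux; rewrite cx eqxx.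
Qed.

Lemma cos_sin_angle_diff x y : cos (x - y) = 1 -> sin (x - y) = 0.
Proof. by move=> h; apply: cos1sin0; rewrite h normr1. Qed.

End trigonometry.

Section directions.
Context d (T : measurableType d) (R : realType) (P : probability T R).
Variable theta : nat -> {RV P >-> R}.
Hypothesis theta_iid : iid_uniform_directions theta.

Let same (z : R * R) : Prop := cos (z.1 - z.2) = 1.

Let measurable_same : measurable [set z | same z].
Proof.
rewrite (_ : [set z | same z] = [set z | cos (z.1 - z.2) == 1]).
  apply: measurable_set_of_bool; apply: measurable_fun_eqr => //.
  apply: (measurableT_comp (f := @cos R)).
    by apply: continuous_measurable_fun; exact: continuous_cos.
  exact: measurable_funB.
by apply/seteqP; split => z /eqP.
Qed.

(** An angle in (0, 2 pi] is determined by its cosine and sine. *)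
Let uniform_same x : uniform_prob (@pi2_gt0 R) [set y | same (x, y)] = 0%E.
Proof.
set U := [set y | _].
have cU : countable (U `&` `[0, 2 * pi]).
  have [[y0 [Uy0 y0I]]|none] := pselect (exists y, U y /\ `]0, 2 * pi]%classic y).
    apply: (@sub_countable _ _ _ [set 0; y0]).
      apply: subset_card_le => y [Uy]; rewrite /= in_itv/= => /andP[].
      rewrite le_eqVlt => /predU1P[<- _|yp yu]; [by left|right].
      move: y0I; rewrite /= in_itv/= => /andP[y0p y0u].
      apply/eqP; rewrite -subr_eq0; apply/eqP; apply: cos_eq1_small; [lra|lra|].
      have -> : y - y0 = (x - y0) - (x - y) by ring.
      rewrite cosB Uy Uy0 (cos_sin_angle_diff Uy) (cos_sin_angle_diff Uy0).
      by rewrite mulr1 mulr0 addr0.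
    by apply: finite_set_countable; exact: finite_set2.
  apply: (@sub_countable _ _ _ [set 0]); last exact: countable1.
  apply: subset_card_le => y [Uy]; rewrite /= in_itv/= => /andP[].
  rewrite le_eqVlt => /predU1P[<- _//|yp yu]; exfalso; apply: none.
  by exists y; split => //=; rewrite in_itv/= yp.
rewrite /uniform_prob integral_uniform_pdf.
have mU : measurable U.
  rewrite (_ : U = xsection [set z | same z] x); first exact: measurable_xsection.
  by rewrite xsectionE.
have mUI : measurable (U `&` `[0, 2 * pi]) by exact: measurableI.
rewrite null_set_integral//.
  by apply/measurable_EFinP/measurable_funTS; exact: measurable_uniform_pdf.
exact: countable_lebesgue_measure0.
Qed.

(** For each value of theta j, only one value in (0, 2 pi] of the independent
    theta j.+1 gives the same direction; the joint law integrates these null sets. *)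
Lemma same_direction_null j :
  P.-negligible [set w | cos (theta j w - theta j.+1 w) = 1].
Proof.
have [indep law] := theta_iid.
have ind2 : independent2 P (sigma_of (theta j)) (sigma_of (theta j.+1)).
  move=> A B FA FB.
  have := indep [:: j; j.+1] (fun k => if k == j then A else B).
  rewrite !big_cons !big_nil eqxx gtn_eqF// setIT mule1; apply.
    by rewrite /= inE ltn_eqF.
  move=> k; rewrite !inE => /orP[] /eqP ->; first by rewrite eqxx.
  by rewrite gtn_eqF.
have mth : measurable_fun [set: T] (fun w => (theta j w, theta j.+1 w)).
  exact: measurable_fun_pair.
have mE : measurable [set w | same (theta j w, theta j.+1 w)].
  by rewrite -[[set w | _]]setTI; exact: mth.
change (P.-negligible [set w | same (theta j w, theta j.+1 w)]).
apply/negligibleP => //.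
apply: etrans (independent_joint_law ind2 measurable_same) _.
apply: integral0_eq => x _ /=.
rewrite /distribution /pushforward law; last exact: measurable_xsection.
by rewrite -[RHS](uniform_same x); congr uniform_prob; rewrite xsectionE.
Qed.

End directions.

Section flight_displacement.
Context d (T : measurableType d) (R : realType) (P : probability T R).
Variables (lambda c : R) (N : R -> {RV P >-> nat}) (s : nat -> T -> R).
Variable theta : nat -> {RV P >-> R}.
Hypothesis lambda_gt0 : 0 < lambda.
Hypothesis c_gt0 : 0 < c.
Hypothesis N_poisson : poisson_process lambda N.
Hypothesis s_times : event_times N s.

Let X := flight_x c N s theta 0.
Let Y := flight_y c N s theta 0.

(** An event at time b is an event in (b - h, b] for every h > 0, which has
    probability at most lambda h. *)
Lemma event_at_fixed_time_null b : 0 < b -> P.-negligible [set w | s (N b w) w = b].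
Proof.
move=> b0.
have mE : measurable [set w | s (N b w) w = b].
  rewrite (_ : [set w | _] = [set w | s (N b w) w == b]); last first.
    by apply/seteqP; split => w /eqP.
  apply: measurable_set_of_bool; apply: measurable_fun_eqr => //.
  apply: measurable_fun_index => // k; exact: (measurable_event_time s_times).
apply/negligibleP => //; apply/eqP; rewrite eq_le measure_ge0 andbT.
apply/lee_addgt0Pr => e e0; rewrite add0e.
pose h := Num.min b (e / lambda).
have h0 : 0 < h by rewrite lt_min b0 divr_gt0.
have hb : h <= b by rewrite ge_min lexx.
have he : lambda * h <= e by rewrite mulrC -ler_pdivlMr// ge_min lexx orbT.
have a0 : 0 <= b - h by lra.
have ab : b - h <= b by lra.
have mu0 : 0 < lambda * (b - (b - h)) by rewrite mulr_gt0//; lra.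
have := prob_poisson_gt0 mu0 (fun A => increment_law N_poisson A a0 ab).
set B := [set w | _] => PB.
apply: (@le_trans _ _ (P B)).
  apply: le_measure; rewrite ?inE//.
    exact: (measurable_nat_preimage (increment_rv N (b - h) b) [set k | (0 < k)%N]).
  move=> w sb; rewrite /B/= /increment subn_gt0 ltnNge; move: sb => /= sb.
  have [_ _ sN] := s_times w; rewrite -sN// sb -ltNge; lra.
rewrite PB lee_fin subKr in mu0 *.
have := expR_ge1Dx (- (lambda * h)); lra.
Qed.

Section pathwise.
Variables (a b : R) (w : T).
Hypotheses (a_ge0 : 0 <= a) (ab : a < b).

Let m := N a w.
Let k := N b w.
Let mk : (m <= k)%N. Proof. exact: (count_mono s_times w a_ge0 (ltW ab)). Qed.
Let L := sojourn a b (s^~ w) m k.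

Let flight_x_incr : X b w - X a w = c * \sum_(m <= j < k.+1) L j * cos (theta j w).
Proof.
rewrite -(sum_sojourn a b (s^~ w) mk (fun j => cos (theta j w))) mulrBr.
by rewrite /X /flight_x !add0r.
Qed.

Let flight_y_incr : Y b w - Y a w = c * \sum_(m <= j < k.+1) L j * sin (theta j w).
Proof.
rewrite -(sum_sojourn a b (s^~ w) mk (fun j => sin (theta j w))) mulrBr.
by rewrite /Y /flight_y !add0r.
Qed.

Let sojourn_ge0 j : (m <= j <= k)%N -> 0 <= L j.
Proof.
have [_ sS sN] := s_times w.
have b0 : 0 <= b by rewrite (le_trans a_ge0)// ltW.
move=> /andP[mj jk]; rewrite /L /sojourn subr_ge0.
case: eqVneq => _; case: eqVneq => [jk0|_].
- exact: ltW.
- by apply: ltW; rewrite ltNge sN// -ltnNge.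
- by rewrite sN// jk0.
- exact: ltW.
Qed.

(** Without an event in (a, b] the path is a segment of length c (b - a). After
    the first event, the second leg has positive length since b is not an event
    time, so that two different directions are used. *)
Lemma displacement_lt : s k w <> b ->
  (forall j, cos (theta j w - theta j.+1 w) <> 1) ->
  (Num.sqrt ((X b w - X a w) ^+ 2 + (Y b w - Y a w) ^+ 2) < c * (b - a))
  = (0 < increment N a b w)%N.
Proof.
move=> sb dir; have [s0 sS sN] := s_times w.
have b0 : 0 <= b by rewrite (le_trans a_ge0)// ltW.
have cba : 0 < c * (b - a) by rewrite mulr_gt0// subr_gt0.
have unit j : cos (theta j w) ^+ 2 + sin (theta j w) ^+ 2 = 1 by rewrite cos2Dsin2.
rewrite flight_x_incr flight_y_incr /increment subn_gt0 -/m -/k.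
rewrite -[X in _ < X]ger0_norm ?(ltW cba)// -sqrtr_sqr ltr_sqrt ?exprn_gt0//.
rewrite !exprMn -mulrDr ltr_pM2l ?exprn_gt0//.
rewrite -(@sojourn_total _ a b (s^~ w) m k mk s0) -/L.
have [km|mltk] := leqP k m.
  have <- : m = k by apply/eqP; rewrite eqn_leq mk.
  rewrite !big_nat1 !exprMn -mulrDr unit mulr1.
  by rewrite ltxx.
apply: polygonal_path_lt => //.
- rewrite /L /sojourn eqxx ltn_eqF// subr_gt0.
  by rewrite ltNge sN// -ltnNge.
- rewrite /L /sojourn (gtn_eqF (ltnSn m)) subr_gt0.
  case: eqVneq => [->|_]; last exact: sS.
  by rewrite lt_neqAle sN// leqnn andbT; apply/eqP.
- by rewrite -cosB; apply/eqP.
Qed.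

End pathwise.

Lemma measurable_flight (f : R -> R) t : measurable_fun [set: R] f ->
  measurable_fun [set: T]
    (fun w => 0 + c * \sum_(0 <= j < (N t w).+1) leg N s t j w * f (theta j w)).
Proof.
move=> mf; pose g k w := 0 + c * \sum_(0 <= j < k.+1)
  ((if j == k then t else s j.+1 w) - s j w) * f (theta j w).
apply: (@measurable_fun_index _ _ _ (N t) g) => // k.
apply: measurable_funD => //; apply: measurable_funM => //.
apply: measurable_sum => j; apply: measurable_funM.
  apply: measurable_funB; last exact: (measurable_event_time s_times).
  by case: (j == k) => //; exact: (measurable_event_time s_times).
exact: (measurableT_comp mf).
Qed.

Lemma measurable_eta (Delta : nat -> R) n i :
  measurable_fun [set: T] (Defs.eta X Y Delta n i).
Proof.
have mc : measurable_fun [set: R] (@cos R).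
  by apply: continuous_measurable_fun; exact: continuous_cos.
have ms : measurable_fun [set: R] (@sin R).
  by apply: continuous_measurable_fun; exact: continuous_sin.
have msq : measurable_fun [set: R] (@Num.sqrt R).
  by apply: continuous_measurable_fun; exact: sqrt_continuous.
apply: (measurableT_comp msq).
by apply: measurable_funD; apply: measurable_funX; apply: measurable_funB;
  exact: measurable_flight.
Qed.

End flight_displacement.

(** * Consistency and the estimator *)

Lemma eq_prob_off_negligible d (T : measurableType d) (R : realType)
  (P : probability T R) (A1 A2 B : set T) :
  measurable A1 -> measurable A2 -> P.-negligible B ->
  (forall w, ~ B w -> A1 w <-> A2 w) -> P A1 = P A2.
Proof.
move=> m1 m2 [C [mC C0 BC]] A12.
have le (A A' : set T) : measurable A -> measurable A' ->
    (forall w, ~ B w -> A w -> A' w) -> (P A <= P A')%E.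
  move=> mA mA' AA'; rewrite -[leRHS]adde0 -C0.
  apply: le_trans (measureU2 _ mA' mC); apply: le_measure; rewrite ?inE//.
    exact: measurableU.
  move=> w Aw; have [Cw|nC] := pselect (C w); [by right|left].
  by apply: AA' => // Bw; exact: nC (BC _ Bw).
by apply/eqP; rewrite eq_le !le// => w nB; have [] := A12 w nB.
Qed.

Section consistency.
Context d (T : measurableType d) (R : realType) (P : probability T R).
Variables (rate : nat -> R) (est : nat -> T -> \bar R) (lambda v : R).
Hypothesis v_gt0 : 0 < v.
Hypothesis cvg_rate : rate n @[n --> \oo] --> +oo.
Hypothesis measurable_est : forall n, measurable_fun [set: T] (est n).
Hypothesis est_normal : forall x : R,
  P [set w | ((rate n)%:E * (est n w - lambda%:E) <= x%:E)%E] @[n --> \oo]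
  --> normal_prob 0 (Num.sqrt v) `]-oo, x].

(** On the scale of the diverging rate, a fixed distance e lies beyond any
    bound M, so the limit probability is at most that of the two normal tails
    beyond M. *)
Lemma normal_consistent : cvg_in_probability P est lambda.
Proof.
have sv0 : 0 < Num.sqrt v by rewrite sqrtr_gt0.
move=> e e0; set Q := fun n => _.
have mZ n : measurable_fun [set: T] (fun w => est n w - lambda%:E)%E.
  by apply: emeasurable_funB.
have mQ n : measurable [set w | (e%:E <= `|est n w - lambda%:E|)%E].
  rewrite -[X in measurable X]setTI.
  by apply: measurable_lee => //; exact: measurableT_comp.
have mA n x : measurable [set w | ((rate n)%:E * (est n w - lambda%:E) <= x%:E)%E].
  rewrite -[X in measurable X]setTI.
  by apply: measurable_lee => //; exact: measurable_funeM.
have tail (eta : R) : 0 < eta -> exists2 M : R, 0 < M &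
    normal_cdf (Num.sqrt v) (- M) < eta.
  move=> eta0; pose F n : set R := `]-oo, (- n%:R)%R]%classic.
  have : normal_prob 0 (Num.sqrt v) (F n) @[n --> \oo]
      --> normal_prob 0 (Num.sqrt v) (\bigcap_n F n).
    apply: nonincreasing_cvg_mu => //=.
    - by rewrite -ge0_fin_numE// fin_num_measure//; exact: measurable_itv.
    - by move=> n; exact: measurable_itv.
    - by apply: bigcap_measurable => [|n _]; [exists 0%N|exact: measurable_itv].
    - move=> m n mn; apply/subsetPset => x; rewrite /F/= !in_itv/= => /le_trans.
      by apply; rewrite lerN2 ler_nat.
  rewrite (_ : \bigcap_n F n = set0); last first.
    rewrite -subset0 => t /(_ (Num.truncn (- t)).+1 I).
    by rewrite /F/= in_itv/= leNgt => /negP; apply; rewrite ltrNl truncnS_gt.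
  rewrite measure0 => /fine_cvg/cvgr_lt/(_ _ eta0) lt_eta.
  near \oo => n; exists n%:R; first by rewrite ltr0n; near: n; exact: nbhs_infty_gt.
  by rewrite /normal_cdf; near: n.
have Qfin n : Q n \is a fin_num by apply: fin_num_measure; exact: mQ.
apply/fine_cvgP; split; first exact: nearW.
apply/cvgrPdist_le => eta eta0.
have eta4 : 0 < eta / 4 by rewrite divr_gt0.
have [M M0 tM] := tail (eta / 4) eta4.
have upper : 1 - normal_cdf (Num.sqrt v) M <= normal_cdf (Num.sqrt v) (- M).
  rewrite -lee_fin EFinB -!normal_cdfE -(normal_prob_tail_sym sv0 (- M)) opprK.
  rewrite -(@probability_setC _ _ _ (normal_prob 0 (Num.sqrt v)))//.
  apply: le_measure; rewrite ?inE//.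
    exact: measurableC.
  by rewrite setCitvl => x/=; rewrite !in_itv/= !andbT => /ltW.
have cM := est_normal (x := M); have cNM := est_normal (x := - M).
rewrite normal_cdfE in cM; rewrite normal_cdfE in cNM.
move/fine_cvg/cvgr_gt : cM => /(_ (normal_cdf (Num.sqrt v) M - eta / 4)).
move=> /(_ ltac:(lra)) cM.
move/fine_cvg/cvgr_lt : cNM => /(_ (normal_cdf (Num.sqrt v) (- M) + eta / 4)).
move=> /(_ ltac:(lra)) cNM.
near=> n.
have r_gt : M / e < rate n by near: n; move/cvgryPgt : cvg_rate; exact.
rewrite ltr_pdivrMr// in r_gt.
have r0 : 0 < rate n by rewrite -(pmulr_lgt0 _ e0) (lt_trans M0).
have h1 : normal_cdf (Num.sqrt v) M - eta / 4 < fine (P [set w |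
    ((rate n)%:E * (est n w - lambda%:E) <= M%:E)%E]) by near: n.
have h2 : fine (P [set w | ((rate n)%:E * (est n w - lambda%:E) <= (- M)%:E)%E])
    < normal_cdf (Num.sqrt v) (- M) + eta / 4 by near: n.
set A1 := [set w | _] in h1; set A2 := [set w | _] in h2.
have sub : [set w | (e%:E <= `|est n w - lambda%:E|)%E] `<=` A2 `|` ~` A1.
  move=> w /=; rewrite /A1 /A2/=; case: (est n w) => [z| |] /=.
  - rewrite -!EFinB -EFinM !lee_fin ler_normr => /orP[h|h]; [right|left].
      by apply/negP; rewrite -ltNge; nra.
    by nra.
  - by move=> _; right; rewrite gt0_muley// leye_eq.
  - by move=> _; left; rewrite gt0_muleNy// leNye.
have : (Q n <= (fine (P A2) + (1 - fine (P A1)))%:E)%E.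
  rewrite EFinD EFinB !fineK ?fin_num_measure//; try exact: mA.
  rewrite -probability_setC; last exact: mA.
  apply: le_trans (measureU2 _ _ _); [|exact: mA|exact: measurableC (mA _ _)].
  apply: le_measure; rewrite ?inE//.
  by apply: measurableU; [exact: mA|exact: measurableC (mA _ _)].
rewrite -[Q n](fineK (Qfin n)) lee_fin.
rewrite /= sub0r normrN ger0_norm ?fine_ge0 ?measure_ge0//.
by move=> h; lra.
Unshelve. all: by end_near. Qed.
End consistency.

Section slow_count.
Context d (T : measurableType d) (R : realType) (P : probability T R).
Variables (lambda c : R) (N : R -> {RV P >-> nat}) (s : nat -> T -> R).
Variables (theta : nat -> {RV P >-> R}) (Delta : nat -> R).
Hypothesis lambda_gt0 : 0 < lambda.
Hypothesis c_gt0 : 0 < c.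
Hypothesis N_poisson : poisson_process lambda N.
Hypothesis s_times : event_times N s.
Hypothesis theta_iid : iid_uniform_directions theta.

Let X := flight_x c N s theta 0.
Let Y := flight_y c N s theta 0.

Definition slow_count n w : nat :=
  \sum_(i < n) (Defs.eta X Y Delta n i.+1 w < c * Delta n)%R.

Lemma measurable_slow_count n : measurable_fun [set: T] (slow_count n).
Proof.
rewrite /slow_count; set D := c * Delta n.
have mb i : measurable_fun [set: T]
    (fun w => nat_of_bool (Defs.eta X Y Delta n i w < D)%R).
  apply: (measurableT_comp (f := nat_of_bool)) => //.
  by apply: measurable_fun_ltr => //; exact: measurable_eta.
rewrite [X in measurable_fun _ X](_ : _ =
  fun w => \sum_(i <- enum 'I_n) nat_of_bool (Defs.eta X Y Delta n i.+1 w < D)%R)%N; last first.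
  by apply/funext => w; rewrite big_enum.
elim: (enum 'I_n) => [|i r IH].
  by under eq_fun do rewrite big_nil; exact: measurable_cst.
by under eq_fun do rewrite big_cons; exact: measurable_fun_addn.
Qed.

(** The number of slow cells and the number of cells containing an event agree
    unless some cell ends at an event time or two consecutive directions coincide. *)
Lemma slow_count_law n (A : set nat) : 0 < Delta n ->
  P [set w | A (slow_count n w)] = P [set w | A (hit_count N (Delta n) n w)].
Proof.
move=> D0.
pose at_grid i := [set w | s (N (i.+1%:R * Delta n) w) w = i.+1%:R * Delta n].
pose same j := [set w | cos (theta j w - theta j.+1 w) = 1].
apply: (@eq_prob_off_negligible _ _ _ _ _ _
  ((\bigcup_i at_grid i) `|` (\bigcup_j same j))).
- by rewrite -[[set w | _]]setTI; exact: measurable_slow_count.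
- exact: measurable_hit_count.
- apply: negligibleU; apply: negligible_bigcup => i.
    apply: (event_at_fixed_time_null lambda_gt0 N_poisson s_times).
    by rewrite mulr_gt0.
  exact: same_direction_null.
move=> w /not_orP[grid dir].
suff E : slow_count n w = hit_count N (Delta n) n w by rewrite /= E.
rewrite /slow_count /hit_count; apply: eq_bigr => i _.
congr nat_of_bool; rewrite /Defs.eta/=.
have -> : c * Delta n = c * (i.+1%:R * Delta n - i%:R * Delta n).
  by rewrite -mulrBl -natrB// subSnn mul1r.
apply: (displacement_lt c_gt0 s_times).
- by rewrite mulr_ge0// ltW.
- by rewrite ltr_pM2r// ltr_nat.
- by move=> e; apply: grid; exists i.
- by move=> j e; apply: dir; exists j.
Qed.

Definition estimate_of_count n (k : nat) : \bar R :=
  if Delta n * ((n%:R * Delta n)^-1 * k%:R) == 1 then +oo%E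
  else (- (Delta n)^-1 * ln (1 - Delta n * ((n%:R * Delta n)^-1 * k%:R)))%:E.

Lemma lambda_dotE n w :
  lambda_dot c X Y Delta n w = estimate_of_count n (slow_count n w).
Proof.
rewrite /lambda_dot /estimate_of_count /G_stat.
have -> : \sum_(1 <= i < n.+1) (if Defs.eta X Y Delta n i w < c * Delta n then 1 else 0)
    = (slow_count n w)%:R :> R.
  rewrite /slow_count natr_sum big_add1/= big_mkord; apply: eq_bigr => i _.
  by case: ifP.
by [].
Qed.

Lemma slow_count_le n w : (slow_count n w <= n)%N.
Proof.
rewrite /slow_count -[leqRHS]card_ord -sum1_card; apply: leq_sum => i _.
by case: (_ < _).
Qed.

(** The estimator is an increasing function of the count k. For k = n it is +oo,
    and both sides are false because the threshold is less than n. *)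
Lemma estimate_le (x : R) n (k : nat) : (0 < n)%N -> 0 < Delta n -> (k <= n)%N ->
  ((Num.sqrt (n%:R * Delta n))%:E * (estimate_of_count n k - lambda%:E) <= x%:E)%E
  = (k%:R <= hit_threshold lambda Delta x n).
Proof.
move=> n0 D0 kn; rewrite /hit_threshold.
set r := Num.sqrt _; have nR : 0 < n%:R :> R by rewrite ltr0n.
have r0 : 0 < r by rewrite sqrtr_gt0 mulr_gt0.
rewrite /estimate_of_count.
have -> : Delta n * ((n%:R * Delta n)^-1 * k%:R) = k%:R / n%:R.
  by field; rewrite !gt_eqF.
set E := expR _; have E0 : 0 < E by exact: expR_gt0.
have -> : (k%:R <= n%:R * (1 - E)) = (k%:R / n%:R <= 1 - E).
  by rewrite ler_pdivrMr// mulrC.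
case: ifPn => [/eqP ->|kn1].
  rewrite addye// gt0_muley ?lte_fin// leye_eq/=.
  by apply/esym/negbTE; rewrite -ltNge; lra.
have q1 : k%:R / n%:R < 1 :> R.
  by rewrite lt_neqAle kn1 ler_pdivrMr// mul1r ler_nat.
have q0 : 0 < 1 - k%:R / n%:R :> R by rewrite subr_gt0.
rewrite -EFinB -EFinM lee_fin.
have -> : (k%:R / n%:R <= 1 - E) = (E <= 1 - k%:R / n%:R).
  by apply/idP/idP; lra.
rewrite /E -[X in expR _ <= X]lnK ?posrE// ler_expR.
rewrite -ler_pdivlMl// lerBlDr mulNr lerNl ler_pdivlMl//.
by rewrite mulrN addrC [r^-1 * x]mulrC.
Qed.

End slow_count.



Theorem theorem3p2 (d : measure_display) (T : measurableType d) (R : realType)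
  (P : probability T R) (lambda c : R)
  (N : R -> {RV P >-> nat}) (s : nat -> T -> R) (theta : nat -> {RV P >-> R})
  (Delta : nat -> R)
  (lambda_gt0 : 0 < lambda) (c_gt0 : 0 < c)
  (N_poisson : poisson_process lambda N)
  (s_times : event_times N s)
  (theta_iid : iid_uniform_directions theta)
  (N_theta_indep : independent_directions N theta)
  (Delta_gt0 : forall n : nat, (0 < n)%N -> 0 < Delta n)
  (horizon : n%:R * Delta n @[n --> \oo] --> +oo)
  (Delta_cvg0 : Delta n @[n --> \oo] --> 0) :
  let X := flight_x c N s theta 0 in
  let Y := flight_y c N s theta 0 in
  let est := lambda_dot c X Y Delta in
  let rate := fun n : nat => Num.sqrt (n%:R * Delta n) in
  [/\ cvg_in_probability P est lambda,
      asymptotically_normal P \oo rate est lambda lambda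
    & asymptotically_efficient N lambda rate est].
Proof.
move=> X Y est rate.
have mono a b w : 0 <= a -> a <= b -> (N a w <= N b w)%N.
  exact: (count_mono s_times).
have mest n : measurable_fun [set: T] (est n).
  rewrite (_ : est n = estimate_of_count Delta n \o
      slow_count c N s theta Delta n); last first.
    by apply/funext => w; exact: lambda_dotE.
  apply: measurableT_comp => //.
  exact: (measurable_slow_count (P := P) c theta Delta s_times).
have limit_law (x : R) :
    P [set w | ((rate n)%:E * (est n w - lambda%:E) <= x%:E)%E] @[n --> \oo]
    --> normal_prob 0 (Num.sqrt lambda) `]-oo, x].
  have := hit_count_central_limit lambda_gt0 N_poisson mono Delta_gt0 horizon
    Delta_cvg0 (x := x).
  apply: cvg_trans; apply: near_eq_cvg; near=> n.
  have n0 : (0 < n)%N by near: n; exact: nbhs_infty_gt.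
  have D0 := Delta_gt0 n n0.
  rewrite -(slow_count_law lambda_gt0 c_gt0 N_poisson s_times theta_iid
    [set k | k%:R <= hit_threshold lambda Delta x n] D0).
  congr (P _); apply/seteqP; split => w /=;
    by rewrite /est lambda_dotE estimate_le// slow_count_le.
have normal : asymptotically_normal P \oo rate est lambda lambda.
  by move=> x _; exact: limit_law.
split => //.
- apply: (normal_consistent lambda_gt0 _ mest (@limit_law)).
  exact: (cvg_comp _ _ horizon (@cvgy_sqrt R)).
exists lambda; split => // x _.
have := count_central_limit lambda_gt0 N_poisson (x := x).
apply: cvg_trans; apply: near_eq_cvg; near=> t.
have t0 : 0 < t by near: t; exact: nbhs_pinfty_gt.
have s0 : 0 < Num.sqrt t by rewrite sqrtr_gt0.
have studentized w : (Num.sqrt t * ((N t w)%:R / t - lambda) <= x)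
    = ((N t w)%:R <= lambda * t + x * Num.sqrt t).
  rewrite -(ler_pM2r s0) mulrAC -expr2 sqr_sqrtr ?(ltW t0)//.
  by rewrite mulrBr mulrCA divff ?gt_eqF// mulr1 [t * _]mulrC lerBlDl.
by congr (P _); apply/seteqP; split => w /=;
  rewrite -EFinB -EFinM lee_fin studentized.
Unshelve. all: by end_near. Qed.
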